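(* Let $G, H$ be topological groups, let $X$ be a Hausdorff space with a $G$-action and let $Y$ be a Hausdorff space with an $H$-action. For every $n \in \mathbb{N}$ there is a weak equivalence of $\mathcal{G}(n)^{op}$-shaped diagrams (of $G\times H$-spaces) $$ \mathbb{L}(U_n^{op})_! \left[ \operatorname{Conf}(-, X) \times \operatorname{Conf}(-, Y) \right] \overset{\sim}{\longrightarrow} \operatorname{Conf}(-,X \times Y), $$ where $\mathbb{L}(U_n^{op})_!$ denotes homotopy left Kan extension along the functor $U_n^{op}\colon \mathcal{G}(n)^{op}\times\mathcal{G}(n)^{op}\to\mathcal{G}(n)^{op}$.
   Context: $\mathcal{G}(n)$ is the poset of (simple, undirected, loopless) graphs on the vertex set $\{1,\ldots,n\}$, ordered by inclusion of edge sets. $U_n\colon \mathcal{G}(n)\times\mathcal{G}(n)\to\mathcal{G}(n)$ sends a pair of graphs to their union. For a graph $\Gamma$ on $\{1,\ldots,n\}$ and a space $Z$, the graphical configuration space is $\operatorname{Conf}(\Gamma,Z) = \{(z_1,\ldots,z_n)\in Z^n : i\sim_\Gamma j \implies z_i\neq z_j\}$ with the subspace topology. An inclusion $\Gamma'\subseteq\Gamma$ induces the inclusion $\operatorname{Conf}(\Gamma,Z)\subseteq\operatorname{Conf}(\Gamma',Z)$, making $\operatorname{Conf}(-,Z)$ a functor $\mathcal{G}(n)^{op}\to\mathrm{Top}$. If a group acts on $Z$, it acts diagonally on $\operatorname{Conf}(\Gamma,Z)$; the product group $G\times H$ acts on $X\times Y$ factorwise. $\operatorname{Conf}(-,X)\times\operatorname{Conf}(-,Y)$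 is the diagram on $\mathcal{G}(n)^{op}\times\mathcal{G}(n)^{op}$ sending $(\Gamma',\Gamma'')$ to $\operatorname{Conf}(\Gamma',X)\times\operatorname{Conf}(\Gamma'',Y)$. A weak equivalence of diagrams is a natural transformation (equivariant for $G \times H$) that is objectwise a weak homotopy equivalence of underlying spaces; homotopy left Kan extension is computed objectwise by $[\mathbb{L}f_!F](d)=\operatorname{hocolim}_{f/d}F$.
   Formalization: The G×H-action on the homotopy Kan extension is only claimed continuous on K × (space) for each compact K in the group (joint continuity if the group is locally compact); in plain Top joint continuity can fail, e.g. for G = Q translating X = Q, Y a point, n = 2. *)

(* Defs.v *)
From HB Require Import structures.
From Stdlib Require Import Relation_Operators.
From mathcomp Require Import all_boot all_order all_algebra.
From mathcomp Require Import all_classical all_reals topology.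

Set Implicit Arguments.
Unset Strict Implicit.
Unset Printing Implicit Defensive.

Import Order.TTheory GRing.Theory Num.Theory.
Import numFieldTopology.Exports.

Local Open Scope classical_set_scope.
Local Open Scope ring_scope.

Lemma pair_continuous (S T U : topologicalType) (f : S -> T) (g : S -> U) :
  continuous f -> continuous g -> continuous (fun s => (f s, g s)).
Proof. by move=> cf cg s; apply: cvg_pair; [exact: cf|exact: cg]. Qed.

Lemma ptws_continuous (S T : topologicalType) (I : eqType)
    (f : S -> {ptws I -> T}) :
  (forall i, continuous (fun s => f s i)) -> continuous f.
Proof.
move=> cf s; apply/cvg_sup => i U [V [[W oW <-] Wfs] WU].
by apply: (filterS WU); apply: cf; exact: open_nbhs_nbhs.
Qed.

Lemma ptws_proj_continuous (T : topologicalType) (I : eqType) (i : I) :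
  continuous (fun f : {ptws I -> T} => f i).
Proof. exact: (@proj_continuous I (fun=> T) i). Qed.

Lemma subtype_continuous (S T : topologicalType) (A : set T)
    (f : S -> set_type A) :
  continuous (fun s => set_val (f s)) -> continuous f.
Proof.
move=> cf s U [V [[W oW <-] Wfs] WU].
by apply: (filterS WU); apply: cf; exact: open_nbhs_nbhs.
Qed.

Lemma set_val_continuous (T : topologicalType) (A : set T) :
  continuous (@set_val T A).
Proof. exact: (@initial_continuous _ _ (@set_val T A)). Qed.

HB.mixin Record Group_isTopological (G : Type) of Topological G & Group G := {
  mulg_continuous : continuous (fun gh : G * G => (gh.1 * gh.2)%g);
  invg_continuous : continuous (fun g : G => (g^-1)%g)
}.

#[short(type="topGroupType")]
HB.structure Definition TopologicalGroup :=
  {G of Topological G & Group G & Group_isTopological G}.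

Section ProdTopologicalGroup.
Variables G H : topGroupType.

Lemma prod_mulg_continuous :
  continuous (fun gh : (G * H) * (G * H) => (gh.1 * gh.2)%g).
Proof.
apply: pair_continuous => u.
- apply: (@continuous_comp _ _ _
    (fun gh : (G * H) * (G * H) => (gh.1.1, gh.2.1)) (fun p => (p.1 * p.2)%g));
    last exact: mulg_continuous.
  by apply: pair_continuous => v; apply: continuous_comp;
    (exact: cvg_fst || exact: cvg_snd).
- apply: (@continuous_comp _ _ _
    (fun gh : (G * H) * (G * H) => (gh.1.2, gh.2.2)) (fun p => (p.1 * p.2)%g));
    last exact: mulg_continuous.
  by apply: pair_continuous => v; apply: continuous_comp;
    (exact: cvg_fst || exact: cvg_snd).
Qed.

Lemma prod_invg_continuous : continuous (fun g : G * H => (g^-1)%g).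
Proof.
apply: pair_continuous => u.
- by apply: continuous_comp; [exact: cvg_fst|exact: invg_continuous].
- by apply: continuous_comp; [exact: cvg_snd|exact: invg_continuous].
Qed.

HB.instance Definition _ := Group_isTopological.Build (G * H)%type
  prod_mulg_continuous prod_invg_continuous.

End ProdTopologicalGroup.

Record gaction (G : topGroupType) (X : topologicalType) := GAction {
  gact :> G -> X -> X;
  gact1 : forall x, gact 1%g x = x;
  gactM : forall g h x, gact (g * h)%g x = gact g (gact h x);
  gact_continuous : continuous (fun gx : G * X => gact gx.1 gx.2)
}.

(* For every compact [K] in [G], the map K x X -> X, (k, x) |-> act k x, is
   jointly continuous.  This is joint continuity in the compactly generated
   sense, and plain joint continuity if [G] is locally compact; see
   [gdiagram]. *)
Definition kcontinuous (G X : topologicalType) (act : G -> X -> X) :=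
  forall K : set G, compact K ->
    continuous (fun kx : set_type K * X => act (set_val kx.1) kx.2).

Lemma continuous_kcontinuous (G X : topologicalType) (act : G -> X -> X) :
  continuous (fun gx : G * X => act gx.1 gx.2) -> kcontinuous act.
Proof.
move=> cact K _ kx.
apply: (@continuous_comp _ _ _
  (fun kx : set_type K * X => (set_val kx.1, kx.2))
  (fun gx : G * X => act gx.1 gx.2)); last exact: cact.
apply: pair_continuous => {}kx; last exact: cvg_snd.
by apply: continuous_comp; [exact: cvg_fst|exact: set_val_continuous].
Qed.

Lemma nbhs_subtype (T : topologicalType) (A : set T) (x : set_type A)
    (U : set (set_type A)) : nbhs x U ->
  exists2 V, nbhs (set_val x) V & forall y : set_type A, V (set_val y) -> U y.
Proof.
move=> [V [[W oW <-] Wx] WU]; exists W; first exact: open_nbhs_nbhs.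
by move=> y Wy; exact: WU.
Qed.

Lemma topgroup_regular (G : topGroupType) : regular_space G.
Proof.
move=> a U Ua.
have : nbhs (1%g : G, a) [set p | U (p.1 * p.2)%g].
  by apply: (@mulg_continuous G (1%g, a)) => /=; rewrite mul1g.
move=> [[V W] /= [V1 Wa] VWU].
have V'1 : nbhs (1%g : G) [set v | V (v^-1)%g].
  by apply: (@invg_continuous G 1%g); rewrite invg1.
exists W => // b clb.
have : nbhs b [set x | V (b / x)%g].
  have : nbhs (b, b) [set p : G * G | V (p.1 / p.2)%g].
    have cdiv : continuous (fun p : G * G => (p.1 / p.2)%g).
      move=> p; apply: (@continuous_comp _ _ _
        (fun p : G * G => (p.1, (p.2^-1)%g)) (fun p => (p.1 * p.2)%g));
        last exact: mulg_continuous.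
      apply: pair_continuous => q; first exact: cvg_fst.
      by apply: continuous_comp; [exact: cvg_snd|exact: invg_continuous].
    by apply: cdiv; rewrite /= mulgV.
  move=> [[P Q] /= [Pb Qb] PQ]; apply: (filterS _ Qb) => x Qx.
  by apply: (PQ (b, x)); split => //; exact: nbhs_singleton Pb.
move=> /clb [x [Wx Vx]].
have := VWU ((b / x)%g, x) (conj Vx Wx).
by rewrite /= mulgVK.
Qed.

Lemma quotient_kcontinuous (G : topGroupType) (T : topologicalType)
    (Q0 : quotType T) (act : G -> T -> T)
    (actQ : G -> quotient_topology Q0 -> quotient_topology Q0) :
  (forall g t, actQ g (\pi_(quotient_topology Q0)%qT t) =
     \pi_(quotient_topology Q0)%qT (act g t)) ->
  kcontinuous act -> kcontinuous actQ.
Proof.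
set pi := (\pi_(quotient_topology Q0))%qT => actpi kact K cK [k0 q0] U0.
rewrite nbhsE => -[U [oU Uk0] UU0].
have oU' : open (pi @^-1` U) by [].
have piK q : pi (repr q) = q by exact: reprK.
pose t0 := repr q0.
have pit0 : pi t0 = q0 by exact: piK.
have : nbhs (k0, t0) [set kt : set_type K * T |
    (pi @^-1` U) (act (set_val kt.1) kt.2)].
  apply: (kact K cK (k0, t0)); apply: open_nbhs_nbhs; split => //=.
  by rewrite -actpi pit0.
move=> [[N M] /= [Nk0 Mt0] NM].
have [N' N'k0 N'N] := nbhs_subtype Nk0.
have [C Ck0 clC] := topgroup_regular N'k0.
pose K0 := K `&` closure C.
have cK0 : compact K0.
  by apply: compact_closedI => //; exact: closed_closure.
pose S := [set t | K0 `<=` [set k | U (pi (act k t))]].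
have oS : open S.
  rewrite openE => t St.
  have cv := (near_covering_withinP K0).2 ((compact_near_coveringP K0).1 cK0).
  apply: (cv T (nbhs t) (fun t k => U (pi (act k t)))).
  move=> k [Kk clk].
  have kK : k \in K by exact: mem_set.
  have : nbhs (SigSub kK : set_type K, t) [set kt : set_type K * T |
      (pi @^-1` U) (act (set_val kt.1) kt.2)].
    apply: (kact K cK (SigSub kK : set_type K, t)).
    by apply: open_nbhs_nbhs; split => //=; exact: St.
  move=> [[P Q] /= [Pk Qt] PQ].
  have [P' P'k P'P] := nbhs_subtype Pk.
  exists (P', Q) => // -[x y] /= [P'x Qy] [Kx _].
  have xK : x \in K by exact: mem_set.
  by apply: (PQ (SigSub xK : set_type K, y)); split => //; exact: P'P.
pose S' := [set q : quotient_topology Q0 | S (repr q)].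
have piS' : pi @^-1` S' = S.
  rewrite eqEsubset; split => t St k K0k /=.
    by rewrite -actpi -(piK (pi t)) actpi; exact: St.
  by rewrite -actpi piK actpi; exact: St.
have oS' : open S' by rewrite /open/= /quotient_open piS'.
have S'q0 : nbhs q0 S'.
  apply: open_nbhs_nbhs; split => // k [Kk clk] /=.
  have kK : k \in K by exact: mem_set.
  apply: (NM (SigSub kK : set_type K, t0)); split => /=.
    by apply: N'N; exact: clC.
  exact: nbhs_singleton Mt0.
have Ck0' : nbhs k0 [set k : set_type K | C (set_val k)].
  exact: (@set_val_continuous _ K k0).
exists ([set k : set_type K | C (set_val k)], S') => // -[k q] /= [Ck S'q].
apply: UU0; rewrite /= -(piK q) actpi; apply: S'q; split.
  exact: set_valP.
exact: subset_closure.
Qed.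

Section ProdAction.
Variables (G H : topGroupType) (X Y : topologicalType).
Variables (a : gaction G X) (b : gaction H Y).

Definition prod_act (gh : G * H) (xy : X * Y) : X * Y :=
  (a gh.1 xy.1, b gh.2 xy.2).

Lemma prod_act1 xy : prod_act 1%g xy = xy.
Proof. by case: xy => x y; rewrite /prod_act !gact1. Qed.

Lemma prod_actM g h xy : prod_act (g * h)%g xy = prod_act g (prod_act h xy).
Proof. by rewrite /prod_act /= !gactM. Qed.

Lemma prod_act_continuous :
  continuous (fun p : (G * H) * (X * Y) => prod_act p.1 p.2).
Proof.
apply: pair_continuous => p.
- apply: (@continuous_comp _ _ _
    (fun p : (G * H) * (X * Y) => (p.1.1, p.2.1)) (fun q => a q.1 q.2));
    last exact: gact_continuous.
  by apply: pair_continuous => q; apply: continuous_comp;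
    (exact: cvg_fst || exact: cvg_snd).
- apply: (@continuous_comp _ _ _
    (fun p : (G * H) * (X * Y) => (p.1.2, p.2.2)) (fun q => b q.1 q.2));
    last exact: gact_continuous.
  by apply: pair_continuous => q; apply: continuous_comp;
    (exact: cvg_fst || exact: cvg_snd).
Qed.

Definition prod_gaction : gaction (G * H)%type (X * Y)%type :=
  GAction prod_act1 prod_actM prod_act_continuous.

End ProdAction.

(* A [gdiagram G P] is a functor from the poset [P] to G-spaces.  The bar
   construction below, formed in the category of all topological spaces, need
   not carry a jointly continuous action when [G] is not locally compact, so
   the values of a diagram are G-spaces in the compactly generated sense of
   [kcontinuous]. *)
Record gdiagram (G : topGroupType) (d : Order.disp_t) (P : porderType d) :=
GDiagram {
  dob :> P -> topologicalType;
  dmap : forall p q : P, (p <= q)%O -> dob p -> dob q;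
  dmap_continuous : forall p q (pq : (p <= q)%O), continuous (dmap pq);
  dmap_id : forall p (pp : (p <= p)%O) x, dmap pp x = x;
  dmap_comp : forall p q r (pq : (p <= q)%O) (qr : (q <= r)%O)
    (pr : (p <= r)%O) x, dmap pr x = dmap qr (dmap pq x);
  dact : forall p, G -> dob p -> dob p;
  dact1 : forall p x, @dact p 1%g x = x;
  dactM : forall p g h x, @dact p (g * h)%g x = dact g (dact h x);
  dact_kcontinuous : forall p, kcontinuous (@dact p);
  dmap_act : forall p q (pq : (p <= q)%O) g x,
    dmap pq (dact g x) = dact g (dmap pq x)
}.

Arguments dmap {G d P} D {p q} pq x : rename.
Arguments dact {G d P} D {p} g x : rename.

Record gdiagram_hom (G : topGroupType) (d : Order.disp_t) (P : porderType d)
    (D E : gdiagram G P) := GDiagramHom {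
  hom_fun :> forall p, D p -> E p;
  hom_continuous : forall p, continuous (@hom_fun p);
  hom_natural : forall p q (pq : (p <= q)%O) x,
    hom_fun (dmap D pq x) = dmap E pq (hom_fun x);
  hom_equivariant : forall p g (x : D p), hom_fun (dact D g x) = dact E g (hom_fun x)
}.

Section ExternalProduct.
Variables (G H : topGroupType) (d d' : Order.disp_t).
Variables (P : porderType d) (Q : porderType d').
Variables (D : gdiagram G P) (E : gdiagram H Q).
Implicit Types pq : (P *p Q)%type.

Definition xprod_ob pq : topologicalType := (D pq.1 * E pq.2)%type.

Lemma le_fst pq pq' : (pq <= pq')%O -> (pq.1 <= pq'.1)%O.
Proof. by rewrite leEprod => /andP[]. Qed.

Lemma le_snd pq pq' : (pq <= pq')%O -> (pq.2 <= pq'.2)%O.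
Proof. by rewrite leEprod => /andP[]. Qed.

Definition xprod_map pq pq' (h : (pq <= pq')%O) (x : xprod_ob pq) :
  xprod_ob pq' := (dmap D (le_fst h) x.1, dmap E (le_snd h) x.2).

Definition xprod_act pq (gh : G * H) (x : xprod_ob pq) : xprod_ob pq :=
  (dact D gh.1 x.1, dact E gh.2 x.2).

Lemma xprod_map_continuous pq pq' (h : (pq <= pq')%O) :
  continuous (xprod_map h).
Proof.
apply: pair_continuous => x; apply: continuous_comp.
- exact: cvg_fst.
- exact: dmap_continuous.
- exact: cvg_snd.
- exact: dmap_continuous.
Qed.

Lemma xprod_map_id pq (h : (pq <= pq)%O) x : xprod_map h x = x.
Proof. by case: x => x y; rewrite /xprod_map !dmap_id. Qed.

Lemma xprod_map_comp p q r (pq : (p <= q)%O) (qr : (q <= r)%O)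
  (pr : (p <= r)%O) x : xprod_map pr x = xprod_map qr (xprod_map pq x).
Proof. by congr pair; exact: dmap_comp. Qed.

Lemma xprod_act1 pq (x : xprod_ob pq) : xprod_act 1%g x = x.
Proof. by case: x => x y; rewrite /xprod_act !dact1. Qed.

Lemma xprod_actM pq g h (x : xprod_ob pq) :
  xprod_act (g * h)%g x = xprod_act g (xprod_act h x).
Proof. by rewrite /xprod_act /= !dactM. Qed.

Lemma xprod_act_kcontinuous pq : kcontinuous (@xprod_act pq).
Proof.
move=> K cK.
have cK1 : compact (fst @` K).
  by apply: continuous_compact => //; apply: continuous_subspaceT => x;
    exact: cvg_fst.
have cK2 : compact (snd @` K).
  by apply: continuous_compact => //; apply: continuous_subspaceT => x;
    exact: cvg_snd.
have K1P (k : set_type K) : (set_val k).1 \in (fst @` K).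
  by apply: mem_set; exists (set_val k) => //; exact: set_valP.
have K2P (k : set_type K) : (set_val k).2 \in (snd @` K).
  by apply: mem_set; exists (set_val k) => //; exact: set_valP.
apply: pair_continuous => p.
- apply: (@continuous_comp _ _ _ (fun p : set_type K * xprod_ob pq =>
      (SigSub (K1P p.1) : set_type (fst @` K), p.2.1))
    (fun q => dact D (set_val q.1) q.2)); last exact: dact_kcontinuous.
  apply: pair_continuous => q; last first.
    by apply: continuous_comp; [exact: cvg_snd|exact: cvg_fst].
  apply: subtype_continuous => {}q /=.
  apply: (@continuous_comp _ _ _ fst
    (fun k : set_type K => (set_val k).1)); first exact: cvg_fst.
  by apply: continuous_comp; [exact: set_val_continuous|exact: cvg_fst].
- apply: (@continuous_comp _ _ _ (fun p : set_type K * xprod_ob pq =>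
      (SigSub (K2P p.1) : set_type (snd @` K), p.2.2))
    (fun q => dact E (set_val q.1) q.2)); last exact: dact_kcontinuous.
  apply: pair_continuous => q; last first.
    by apply: continuous_comp; [exact: cvg_snd|exact: cvg_snd].
  apply: subtype_continuous => {}q /=.
  apply: (@continuous_comp _ _ _ fst
    (fun k : set_type K => (set_val k).2)); first exact: cvg_fst.
  by apply: continuous_comp; [exact: set_val_continuous|exact: cvg_snd].
Qed.

Lemma xprod_map_act p q (pq : (p <= q)%O) g x :
  xprod_map pq (xprod_act g x) = xprod_act g (xprod_map pq x).
Proof. by rewrite /xprod_map /= !dmap_act. Qed.

Definition xprod : gdiagram (G * H)%type (P *p Q)%type :=
  GDiagram xprod_map_continuous xprod_map_id xprod_map_comp xprod_act1
    xprod_actM xprod_act_kcontinuous xprod_map_act.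

End ExternalProduct.

Section Simplex.
Variable R : realType.

Definition simplex k : set {ptws 'I_k.+1 -> R} :=
  [set t | (forall i, 0 <= t i) /\ \sum_i t i = 1].
Arguments simplex : clear implicits.

Definition simplex_push k m (theta : 'I_m.+1 -> 'I_k.+1)
  (t : {ptws 'I_m.+1 -> R}) : {ptws 'I_k.+1 -> R} :=
  fun i => \sum_(j | theta j == i) t j.

Lemma simplex_pushP k m (theta : 'I_m.+1 -> 'I_k.+1) (t : simplex m) :
  simplex_push theta (set_val t) \in simplex k.
Proof.
have [t0 t1] : simplex m (set_val t) by exact: set_valP.
apply: mem_set; split=> [i|]; first exact: sumr_ge0.
by rewrite -[RHS]t1 [RHS](partition_big theta xpredT).
Qed.

Definition simplex_map k m (theta : 'I_m.+1 -> 'I_k.+1) (t : simplex m) :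
  simplex k := SigSub (simplex_pushP theta t).

End Simplex.
Arguments simplex : clear implicits.

(* The homotopy colimit of the restriction of [F] to the full subposet [A] of
   [P], as the geometric realization of the simplicial space
   [k] |-> \coprod_(c_0 <= ... <= c_k in A) F(c_0). *)
Section Hocolim.
Variables (R : realType) (G : topGroupType) (d : Order.disp_t).
Variables (P : porderType d) (F : gdiagram G P) (A : {pred P}).

Definition is_chain k (c : {ffun 'I_k.+1 -> P}) : bool :=
  [forall i, c i \in A] &&
  [forall i : 'I_k.+1, forall j : 'I_k.+1, (i <= j)%N ==> (c i <= c j)%O].

Definition chain k := {c : {ffun 'I_k.+1 -> P} | is_chain c}.

Lemma chain_le k (c : chain k) (i j : 'I_k.+1) :
  (i <= j)%N -> (val c i <= val c j)%O.
Proof.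
by case: c => c /= /andP[_ /forallP/(_ i)/forallP/(_ j)/implyP]; apply.
Qed.

Lemma chain_in k (c : chain k) i : val c i \in A.
Proof. by case: c => c /= /andP[/forallP]. Qed.

Lemma chain_compP k m (c : chain k) (theta : 'I_m.+1 -> 'I_k.+1) :
  {homo theta : i j / (i <= j)%N} -> is_chain [ffun i => val c (theta i)].
Proof.
move=> htheta; apply/andP; split; apply/forallP => i.
  by rewrite ffunE chain_in.
by apply/forallP => j; apply/implyP => ij; rewrite !ffunE chain_le// htheta.
Qed.

Definition chain_comp k m (c : chain k) (theta : 'I_m.+1 -> 'I_k.+1)
  (htheta : {homo theta : i j / (i <= j)%N}) : chain m :=
  exist (fun b => is_true (is_chain b)) _ (chain_compP c htheta).

Lemma chain_comp_ge k m (c : chain k) (theta : 'I_m.+1 -> 'I_k.+1)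
  (htheta : {homo theta : i j / (i <= j)%N}) :
  (val c ord0 <= val (chain_comp c htheta) ord0)%O.
Proof. by rewrite ffunE chain_le. Qed.

Definition bar_piece (c : {k & chain k}) : topologicalType :=
  (F (val (tagged c) ord0) * simplex R (tag c))%type.

Definition bar : topologicalType := {c : {k & chain k} & bar_piece c}.

Definition bar_point k (c : chain k) (x : F (val c ord0)) (t : simplex R k) :
  bar := existT bar_piece (existT chain k c) (x, t).

(* (theta^* (c, x), t) is glued to ((c, x), theta_* t) for each map theta of
   the simplex category. *)
Inductive bar_step : bar -> bar -> Prop :=
| BarStep k m (c : chain k) (theta : 'I_m.+1 -> 'I_k.+1)
    (htheta : {homo theta : i j / (i <= j)%N})
    (x : F (val c ord0)) (t : simplex R m) :
    bar_step (bar_point x (simplex_map theta t))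
      (@bar_point m (chain_comp c htheta) (dmap F (chain_comp_ge c htheta) x) t).

Definition bar_rel (a b : bar) : bool := `[< clos_refl_sym_trans _ bar_step a b >].

Lemma bar_rel_refl : reflexive bar_rel.
Proof. by move=> a; apply/asboolP; exact: rst_refl. Qed.

Lemma bar_rel_sym : symmetric bar_rel.
Proof. by move=> a b; apply/asboolP/asboolP; exact: rst_sym. Qed.

Lemma bar_rel_trans : transitive bar_rel.
Proof.
by move=> b a c /asboolP ab /asboolP bc; apply/asboolP; exact: rst_trans ab bc.
Qed.

Canonical bar_equiv := EquivRel bar_rel bar_rel_refl bar_rel_sym bar_rel_trans.

Definition hocolim : topologicalType :=
  quotient_topology {eq_quot bar_equiv}%qT.

Definition hocolim_pi (a : bar) : hocolim :=
  (\pi_(quotient_topology {eq_quot bar_equiv}) a)%qT.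

Lemma hocolim_pi_continuous : continuous hocolim_pi.
Proof. exact: pi_continuous. Qed.

Lemma hocolim_pi_eq a b : bar_rel a b -> hocolim_pi a = hocolim_pi b.
Proof. by move=> ab; apply/eqquotP. Qed.

Lemma hocolim_repr a : bar_rel (repr (hocolim_pi a)) a.
Proof. by apply/eqquotP; exact: (@reprK _ {eq_quot bar_equiv}%qT (hocolim_pi a)). Qed.

End Hocolim.

Section HocolimMap.
Variables (R : realType) (G : topGroupType) (d : Order.disp_t).
Variables (P : porderType d) (F : gdiagram G P).

Section Descend.
Variables (A B : {pred P}) (phi : bar R F A -> bar R F B).
Hypothesis phi_step : forall a b, bar_step a b -> bar_step (phi a) (phi b).

Definition hocolim_descend (x : hocolim R F A) : hocolim R F B :=
  hocolim_pi (phi (repr x)).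

Lemma hocolim_descendE a :
  hocolim_descend (hocolim_pi a) = hocolim_pi (phi a).
Proof.
suff phi_equiv u v : clos_refl_sym_trans _ (@bar_step R _ _ _ F A) u v ->
    clos_refl_sym_trans _ (@bar_step R _ _ _ F B) (phi u) (phi v).
  by apply: hocolim_pi_eq; apply/asboolP/phi_equiv/asboolP/hocolim_repr.
elim=> {u v} [u v uv|u|u v _ uv|u v w _ uv _ vw].
- exact/rst_step/phi_step.
- exact: rst_refl.
- exact: rst_sym.
- exact: rst_trans uv vw.
Qed.

Lemma hocolim_descend_continuous :
  continuous phi -> continuous hocolim_descend.
Proof.
move=> cphi; apply/quotient_continuous.
have eqf : hocolim_descend \o @hocolim_pi R _ _ _ F A =
    @hocolim_pi R _ _ _ F B \o phi.
  by apply: funext => b; exact: hocolim_descendE.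
suff : continuous (hocolim_descend \o @hocolim_pi R _ _ _ F A) by [].
rewrite eqf => a; apply: continuous_comp; first exact: cphi.
exact: hocolim_pi_continuous.
Qed.

End Descend.

Lemma hocolim_ind (A : {pred P}) (S : hocolim R F A -> Prop) :
  (forall a, S (hocolim_pi a)) -> forall x, S x.
Proof. by move=> Spi x; have := Spi (repr x); rewrite /hocolim_pi reprK. Qed.

Section Inclusion.
Variables (A B : {pred P}).
Hypothesis AB : {subset A <= B}.

Lemma chain_inclP k (c : chain A k) : is_chain B (val c).
Proof.
apply/andP; split; apply/forallP => i; first exact/AB/chain_in.
by apply/forallP => j; apply/implyP; exact: chain_le.
Qed.

Definition chain_incl k (c : chain A k) : chain B k :=
  exist (fun b => is_true (is_chain B b)) _ (chain_inclP c).

Definition bar_incl (a : bar R F A) : bar R F B :=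
  let: existT (existT k c) xt := a in
  existT (bar_piece R F (A := B)) (existT (chain B) k (chain_incl c)) xt.

Lemma bar_incl_step a b : bar_step a b -> bar_step (bar_incl a) (bar_incl b).
Proof.
case=> k m c theta htheta x t.
have := BarStep (c := chain_incl c) htheta x t.
rewrite /chain_comp (bool_irrelevance (chain_compP (chain_incl c) htheta)
  (chain_inclP (chain_comp c htheta))).
by rewrite (bool_irrelevance (chain_comp_ge (chain_incl c) htheta)
  (chain_comp_ge c htheta)).
Qed.

Lemma bar_incl_continuous : continuous bar_incl.
Proof.
move=> [[k c] xt] U nU.
exact: (@existT_continuous _ (bar_piece R F (A := B))
  (existT (chain B) k (chain_incl c)) xt U nU).
Qed.

Definition hocolim_incl : hocolim R F A -> hocolim R F B :=
  hocolim_descend bar_incl.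

End Inclusion.

Section Action.
Variables (A : {pred P}).

Definition bar_act (g : G) (a : bar R F A) : bar R F A :=
  let: existT (existT k c) xt := a in
  bar_point (c := c) (dact F g xt.1) xt.2.

Lemma bar_act_step g a b : bar_step a b -> bar_step (bar_act g a) (bar_act g b).
Proof.
case=> k m c theta htheta x t /=.
by rewrite /bar_point /= -dmap_act; exact: BarStep.
Qed.

Lemma bar_act_kcontinuous : kcontinuous bar_act.
Proof.
move=> K cK [k [[m c] [x t]]] U nU.
set i := existT (chain A) m c in x t nU *.
have : nbhs (dact F (set_val k) x, t)
    [set y : bar_piece R F i | U (existT (bar_piece R F (A := A)) i y)] by [].
move=> [[N M] /= [Nx Mt] NMU].
have := @dact_kcontinuous _ _ _ F _ K cK (k, x) N Nx.
move=> [[V W] /= [Vk Wx] VWN].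
exists (V, existT (bar_piece R F (A := A)) i @` (W `*` M)) => /=.
  split=> //; apply: existT_nbhs.
  by exists (W, M).
move=> [k' _] /= [Vk' [[y s] /= [Wy Ms] <-]].
by apply: NMU; split => //=; exact: (VWN (k', y)).
Qed.

Definition hocolim_act (g : G) : hocolim R F A -> hocolim R F A :=
  hocolim_descend (bar_act g).

Lemma hocolim_act_kcontinuous : kcontinuous hocolim_act.
Proof.
apply: quotient_kcontinuous bar_act_kcontinuous => g a.
by apply: hocolim_descendE; exact: bar_act_step.
Qed.

End Action.
End HocolimMap.

(* Homotopy left Kan extension along [f], computed at [q] as the homotopy
    colimit over the slice [f/q], the subposet of all [p] with [f p <= q]. *)
Section LKan.
Variables (R : realType) (G : topGroupType) (d d' : Order.disp_t).
Variables (P : porderType d) (Q : porderType d') (f : {omorphism P -> Q}).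
Variable (F : gdiagram G P).

Definition slice (q : Q) : {pred P} := [pred p | (f p <= q)%O].

Definition lkan_ob (q : Q) : topologicalType := hocolim R F (slice q).

Lemma slice_sub q q' : (q <= q')%O -> {subset slice q <= slice q'}.
Proof. by move=> qq' p; rewrite !inE => /le_trans; exact. Qed.

Definition lkan_map q q' (h : (q <= q')%O) : lkan_ob q -> lkan_ob q' :=
  hocolim_incl (slice_sub h).

Definition lkan_act q (g : G) : lkan_ob q -> lkan_ob q := hocolim_act g.

Lemma lkan_mapE q q' (h : (q <= q')%O) a :
  lkan_map h (hocolim_pi a) = hocolim_pi (bar_incl (slice_sub h) a).
Proof. by apply: hocolim_descendE; exact: bar_incl_step. Qed.

Lemma lkan_actE q g (a : bar R F (slice q)) :
  @lkan_act q g (hocolim_pi a) = hocolim_pi (bar_act g a).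
Proof. by apply: hocolim_descendE; exact: bar_act_step. Qed.

Lemma lkan_map_continuous q q' (h : (q <= q')%O) : continuous (lkan_map h).
Proof.
apply: hocolim_descend_continuous; last exact: bar_incl_continuous.
exact: bar_incl_step.
Qed.

Lemma lkan_map_id q (h : (q <= q)%O) x : lkan_map h x = x.
Proof.
elim/hocolim_ind: x => -[[k c] xt]; rewrite lkan_mapE; congr hocolim_pi.
rewrite /bar_incl; case: c xt => c hc xt; rewrite /chain_incl /=.
pose c0 : chain (slice q) k :=
  exist (fun b => is_true (is_chain (slice q) b)) c hc.
by rewrite (bool_irrelevance (chain_inclP (slice_sub h) c0) hc).
Qed.

Lemma lkan_map_comp q q' q'' (h : (q <= q')%O) (h' : (q' <= q'')%O)
  (h'' : (q <= q'')%O) x : lkan_map h'' x = lkan_map h' (lkan_map h x).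
Proof.
elim/hocolim_ind: x => -[[k c] xt]; rewrite !lkan_mapE; congr hocolim_pi.
rewrite /bar_incl /chain_incl /=.
by rewrite (bool_irrelevance (chain_inclP (slice_sub h'') c)
  (chain_inclP (slice_sub h') (chain_incl (slice_sub h) c))).
Qed.

Lemma lkan_act1 q x : @lkan_act q 1%g x = x.
Proof.
elim/hocolim_ind: x => -[[k c] [x t]]; rewrite lkan_actE; congr hocolim_pi.
by rewrite /bar_act /= dact1.
Qed.

Lemma lkan_actM q g h x :
  @lkan_act q (g * h)%g x = lkan_act g (lkan_act h x).
Proof.
elim/hocolim_ind: x => -[[k c] [x t]]; rewrite !lkan_actE; congr hocolim_pi.
by rewrite /bar_act /= dactM.
Qed.

Lemma lkan_act_kcontinuous q : kcontinuous (@lkan_act q).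
Proof. exact: hocolim_act_kcontinuous. Qed.

Lemma lkan_map_act q q' (h : (q <= q')%O) g x :
  lkan_map h (lkan_act g x) = lkan_act g (lkan_map h x).
Proof.
elim/hocolim_ind: x => -[[k c] [x t]].
by rewrite lkan_mapE !lkan_actE lkan_mapE.
Qed.

Definition lkan : gdiagram G Q :=
  GDiagram lkan_map_continuous lkan_map_id lkan_map_comp lkan_act1 lkan_actM
    lkan_act_kcontinuous lkan_map_act.

End LKan.

(* Simple graphs with vertex set 'I_n, given by their sets of edges. *)
Record graph n := Graph {
  edges :> {set {set 'I_n}};
  edges_card : [forall e in edges, #|e| == 2]
}.

HB.instance Definition _ n := [isSub for @edges n].
HB.instance Definition _ n := [Finite of graph n by <:].

Definition adj n (Gam : graph n) (i j : 'I_n) : bool :=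
  [set i; j]%SET \in edges Gam.

Lemma adj_sym n (Gam : graph n) : symmetric (adj Gam).
Proof. by move=> i j; rewrite /adj finset.setUC. Qed.

Lemma adj_irr n (Gam : graph n) : irreflexive (adj Gam).
Proof.
move=> i; apply/negP; rewrite /adj => ii.
by have /forall_inP/(_ _ ii) := edges_card Gam; rewrite cards2 eqxx.
Qed.

Fact graph_display : Order.disp_t. Proof. exact: (Order.Disp tt tt). Qed.

Definition subgraph n (Gam Gam' : graph n) : bool := edges Gam \subset edges Gam'.

Lemma subgraph_refl n : reflexive (@subgraph n).
Proof. by move=> Gam; exact: subxx. Qed.

Lemma subgraph_anti n : antisymmetric (@subgraph n).
Proof. by move=> Gam Gam' h; apply/val_inj/eqP; rewrite finset.eqEsubset. Qed.

Lemma subgraph_trans n : transitive (@subgraph n).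
Proof. by move=> Gam2 Gam1 Gam3; exact: fintype.subset_trans. Qed.

HB.instance Definition _ n := Order.Le_isPOrder.Build graph_display (graph n)
  (@subgraph_refl n) (@subgraph_anti n) (@subgraph_trans n).

Lemma graph_unionP n (Gam Gam' : graph n) :
  [forall e in edges Gam :|: edges Gam', #|e| == 2].
Proof.
apply/forall_inP => e; rewrite finset.inE => /orP[] eG.
- by have /forall_inP := edges_card Gam; apply.
- by have /forall_inP := edges_card Gam'; apply.
Qed.

Definition graph_union n (GG : graph n * graph n) : graph n :=
  Graph (graph_unionP GG.1 GG.2).

Definition graph_union_op n (GG : ((graph n)^d *p (graph n)^d)%type) :
  (graph n)^d := graph_union GG.

Lemma graph_union_op_le n : {homo @graph_union_op n : x y / (x <= y)%O}.
Proof. by move=> x y; rewrite leEprod => /andP[]; exact: finset.setUSS. Qed.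

HB.instance Definition _ n := Order.isOrderMorphism.Build _ _ _ _
  (@graph_union_op n) (@graph_union_op_le n).

Section Conf.
Variables (n : nat) (Z : topologicalType).

Definition conf (Gam : graph n) : set {ptws 'I_n -> Z} :=
  [set z | forall i j, adj Gam i j -> z i <> z j].

Lemma conf_sub (Gam Gam' : graph n) :
  (Gam' <= Gam)%O -> conf Gam `<=` conf Gam'.
Proof. by move=> /fintype.subsetP GG z cz i j ij; apply: cz; exact: GG. Qed.

End Conf.
Arguments conf {n} Z Gam.

Section ConfDiagram.
Variables (n : nat) (G : topGroupType) (Z : topologicalType) (a : gaction G Z).

Definition conf_ob (Gam : (graph n)^d) : topologicalType := set_type (conf Z Gam).

Lemma conf_mapP (Gam Gam' : (graph n)^d) (h : (Gam <= Gam')%O)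
  (z : conf_ob Gam) : set_val z \in conf Z Gam'.
Proof. by apply: mem_set; apply: (conf_sub h); exact: set_valP. Qed.

Definition conf_map (Gam Gam' : (graph n)^d) (h : (Gam <= Gam')%O)
  (z : conf_ob Gam) : conf_ob Gam' := SigSub (conf_mapP h z).

Lemma conf_actP (Gam : (graph n)^d) g (z : conf_ob Gam) :
  (fun i => a g (set_val z i)) \in conf Z Gam.
Proof.
apply: mem_set => i j ij ea; apply: (set_valP z i j ij).
by rewrite -[LHS](gact1 a) -[RHS](gact1 a) -(mulVg g) !gactM ea.
Qed.

Definition conf_act (Gam : (graph n)^d) g (z : conf_ob Gam) : conf_ob Gam :=
  SigSub (conf_actP g z).

Lemma conf_map_continuous (Gam Gam' : (graph n)^d) (h : (Gam <= Gam')%O) :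
  continuous (conf_map h).
Proof. by apply: subtype_continuous; exact: set_val_continuous. Qed.

Lemma conf_map_id (Gam : (graph n)^d) (h : (Gam <= Gam)%O) z : conf_map h z = z.
Proof. exact: val_inj. Qed.

Lemma conf_map_comp (Gam Gam' Gam'' : (graph n)^d) (h : (Gam <= Gam')%O)
  (h' : (Gam' <= Gam'')%O) (h'' : (Gam <= Gam'')%O) z :
  conf_map h'' z = conf_map h' (conf_map h z).
Proof. exact: val_inj. Qed.

Lemma conf_act1 (Gam : (graph n)^d) (z : conf_ob Gam) : conf_act 1%g z = z.
Proof. by apply/val_inj/funext => i /=; rewrite gact1. Qed.

Lemma conf_actM (Gam : (graph n)^d) g h (z : conf_ob Gam) :
  conf_act (g * h)%g z = conf_act g (conf_act h z).
Proof. by apply/val_inj/funext => i /=; rewrite gactM. Qed.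

Lemma conf_act_kcontinuous (Gam : (graph n)^d) : kcontinuous (@conf_act Gam).
Proof.
apply: continuous_kcontinuous; apply: subtype_continuous.
apply: ptws_continuous => i gz.
apply: (@continuous_comp _ _ _
  (fun gz : G * conf_ob Gam => (gz.1, set_val gz.2 i)) (fun p => a p.1 p.2));
  last exact: gact_continuous.
apply: pair_continuous => {}gz; first exact: cvg_fst.
apply: (@continuous_comp _ _ _ snd (fun z : conf_ob Gam => set_val z i));
  first exact: cvg_snd.
apply: (@continuous_comp _ _ _ (@set_val _ (conf Z Gam))
  (fun z : {ptws 'I_n -> Z} => z i)); first exact: set_val_continuous.
exact: ptws_proj_continuous.
Qed.

Lemma conf_map_act (Gam Gam' : (graph n)^d) (h : (Gam <= Gam')%O) g z :
  conf_map h (conf_act g z) = conf_act g (conf_map h z).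
Proof. exact: val_inj. Qed.

Definition conf_diagram : gdiagram G (graph n)^d :=
  GDiagram conf_map_continuous conf_map_id conf_map_comp conf_act1 conf_actM
    conf_act_kcontinuous conf_map_act.

End ConfDiagram.
Arguments conf_diagram n {G Z} a.

Section WeakEquivalence.
Variable R : realType.

Definition unit_interval : topologicalType := set_type (`[0, 1] : set R).

Definition cube k : topologicalType := {ptws 'I_k -> unit_interval}.

Definition cube_bdry k : set (cube k) :=
  [set s | exists i, set_val (s i) = 0 \/ set_val (s i) = 1].

(* [a] represents an element of pi_k(X, x). *)
Definition based_map (X : topologicalType) (x : X) k (a : cube k -> X) : Prop :=
  continuous a /\ forall s, cube_bdry s -> a s = x.

(* Homotopy relative to the boundary of the cube, that is, equality in
   pi_k(X, x). *)
Definition based_homotopic (X : topologicalType) (x : X) k (a b : cube k -> X) :=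
  exists h : unit_interval * cube k -> X,
    [/\ continuous h,
        forall u s, set_val u = 0 -> h (u, s) = a s,
        forall u s, set_val u = 1 -> h (u, s) = b s
      & forall u s, cube_bdry s -> h (u, s) = x].

Definition path_joined (X : topologicalType) (x y : X) :=
  exists c : unit_interval -> X,
    [/\ continuous c, forall u, set_val u = 0 -> c u = x
      & forall u, set_val u = 1 -> c u = y].

Definition pi0_bijective (X Y : topologicalType) (f : X -> Y) :=
  (forall x x', path_joined (f x) (f x') -> path_joined x x') /\
  (forall y, exists x, path_joined (f x) y).

Definition pi_bijective k (X Y : topologicalType) (f : X -> Y) (x : X) :=
  (forall a b : cube k -> X, based_map x a -> based_map x b ->
     based_homotopic (f x) (f \o a) (f \o b) -> based_homotopic x a b) /\
  (forall b : cube k -> Y, based_map (f x) b ->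
     exists2 a : cube k -> X, based_map x a & based_homotopic (f x) (f \o a) b).

Definition weak_homotopy_equivalence (X Y : topologicalType) (f : X -> Y) :=
  [/\ continuous f, pi0_bijective f
    & forall (x : X) k, (0 < k)%N -> pi_bijective k f x].

Definition diagram_weak_equivalence (G : topGroupType) (d : Order.disp_t)
    (P : porderType d) (D E : gdiagram G P) (eta : gdiagram_hom D E) :=
  forall p, weak_homotopy_equivalence (eta p).

End WeakEquivalence.

(* Main.v *)
(** A point of the homotopy colimit over [Gam] is a class of triples: a chain of
    pairs of graphs [(Gam', Gam'')] with union containing [Gam], a point [(x, y)]
    allowed by the largest pair, and barycentric weights.  Forgetting chain and
    weights gives the map to [Conf(Gam, X * Y)].

    Let [T] be two copies of the set of possible edges, so that a pair of graphs
    is a subset of [T].  The total weight of the members of the chain containing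
    [s : T] is a coordinate in [0, 1], and the chain with its weights is
    recovered from the superlevel sets of these coordinates.  Thus the homotopy
    colimit is, as a set, the set of [(z, w)] in [(X * Y)^n * [0, 1]^T] such that
    [w s > 0] implies [z] in the open set [V s] where [s] is not a collision, and
    [max (w (true, e)) (w (false, e)) = 1] for each edge [e] of [Gam]; these
    conditions are stable under pointwise maxima.  The topology is finer than the
    induced one, but a map with continuous coordinates is continuous wherever
    the closure of the support of each [w s] lies over [V s].

    This gives relative lifting for cubes: pushing small coordinates to zero makes
    a partial lift satisfy the support condition, a lift with the support
    condition exists over any cube since cubes are perfectly normal, and the two
    are interpolated by maxima in a collar of the boundary. *)
Require Import Defs.
From HB Require Import structures.
From Stdlib Require Import Relation_Operators.
From mathcomp Require Import all_boot all_order all_algebra.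
From mathcomp Require Import all_classical all_reals topology normedtype.
From mathcomp Require Import ring lra.

Set Implicit Arguments.
Unset Strict Implicit.
Unset Printing Implicit Defensive.

Import Order.TTheory GRing.Theory Num.Theory.
Import numFieldTopology.Exports numFieldNormedType.Exports.

Local Open Scope classical_set_scope.
Local Open Scope ring_scope.

(** * Limits in subspaces and products, and of finite maxima and minima *)

Section InitialLimits.
Variables (S : Type) (F : set_system S).
Context {FF : Filter F}.

Lemma cvg_ptws (T : topologicalType) (I : eqType) (f : S -> {ptws I -> T})
    (l : {ptws I -> T}) :
  (forall i, f s i @[s --> F] --> l i) -> f s @[s --> F] --> l.
Proof.
move=> cf; apply/cvg_sup => i U [V [[W oW <-] Wl] WU].
by apply: (filterS WU); apply: cf; exact: open_nbhs_nbhs.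
Qed.

Lemma cvg_subtype (T : topologicalType) (A : set T) (f : S -> set_type A)
    (l : set_type A) :
  set_val (f s) @[s --> F] --> set_val l -> f s @[s --> F] --> l.
Proof.
move=> cf U [V [[W oW <-] Wl] WU].
by apply: (filterS WU); apply: cf; exact: open_nbhs_nbhs.
Qed.

End InitialLimits.

(** For pasting along a finite closed cover: at a point off [C] the implication is vacuous on the
    open complement, so each closed piece is examined only at its own points. *)
Lemma near_closed (K : topologicalType) (C : set K) (Q : set K) (x : K) :
  closed C -> (C x -> \forall y \near x, C y -> Q y) ->
  \forall y \near x, C y -> Q y.
Proof.
move=> clC CQ; have [/CQ//|NCx] := pselect (C x).
have : nbhs x (~` C) by apply: open_nbhs_nbhs; split => //; exact: closed_openC.
by apply: filterS => y.
Qed.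

Section RealLimits.
Variables (R : realType) (S : Type) (F : set_system S).
Context {FF : Filter F}.
Implicit Types (f g : S -> R) (a b : R).

Lemma cvgr_max f g a b : f x @[x --> F] --> a -> g x @[x --> F] --> b ->
  Num.max (f x) (g x) @[x --> F] --> Num.max a b.
Proof.
move=> fa gb; rewrite maxr_absE.
under eq_cvg do rewrite maxr_absE.
by apply: cvgM; [apply: cvgD; [exact: cvgD|apply: cvg_norm; exact: cvgB]
  |exact: cvg_cst].
Qed.

Lemma cvgr_min f g a b : f x @[x --> F] --> a -> g x @[x --> F] --> b ->
  Num.min (f x) (g x) @[x --> F] --> Num.min a b.
Proof.
move=> fa gb; rewrite minr_absE.
under eq_cvg do rewrite minr_absE.
by apply: cvgM; [apply: cvgB; [exact: cvgD|apply: cvg_norm; exact: cvgB]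
  |exact: cvg_cst].
Qed.

Lemma cvgr_sum (I : Type) (r : seq I) (P : pred I) (f : I -> S -> R)
    (a : I -> R) : (forall i, P i -> f i x @[x --> F] --> a i) ->
  \sum_(i <- r | P i) f i x @[x --> F] --> \sum_(i <- r | P i) a i.
Proof. by apply: cvg_big => // x; exact: add_continuous. Qed.

Lemma cvgr_bigmax (I : Type) (r : seq I) (P : pred I) (f : I -> S -> R)
    (a : I -> R) c : (forall i, P i -> f i x @[x --> F] --> a i) ->
  \big[Num.max/c]_(i <- r | P i) f i x @[x --> F] -->
    \big[Num.max/c]_(i <- r | P i) a i.
Proof.
move=> fa; elim: r => [|i r IHr].
  by under eq_cvg do rewrite big_nil; rewrite big_nil; exact: cvg_cst.
under eq_cvg do rewrite big_cons.
by rewrite big_cons; case: ifPn => // Pi; apply: cvgr_max => //; exact: fa.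
Qed.

Lemma cvgr_bigmin (I : Type) (r : seq I) (P : pred I) (f : I -> S -> R)
    (a : I -> R) c : (forall i, P i -> f i x @[x --> F] --> a i) ->
  \big[Num.min/c]_(i <- r | P i) f i x @[x --> F] -->
    \big[Num.min/c]_(i <- r | P i) a i.
Proof.
move=> fa; elim: r => [|i r IHr].
  by under eq_cvg do rewrite big_nil; rewrite big_nil; exact: cvg_cst.
under eq_cvg do rewrite big_cons.
by rewrite big_cons; case: ifPn => // Pi; apply: cvgr_min => //; exact: fa.
Qed.

End RealLimits.

(** * Gaps of sorted sequences, and sorting as a continuous operation *)

Section SortedSequences.
Variable R : realType.
Implicit Types (x a : R) (s : seq R).

(** The gaps starting strictly below [a] form an initial segment of the sequence. As [a] is itself
    an entry, the last of them ends exactly at [a], and the sum telescopes. *)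
Lemma sum_gaps x s a : path <=%R x s -> a \in x :: s ->
  \sum_(i < size s | nth 0 (x :: s) i < a)
    (nth 0 s i - nth 0 (x :: s) i) = a - x.
Proof.
elim: s x => [|y s IHs] x /= xs; rewrite in_cons.
  by rewrite in_nil orbF => /eqP ->; rewrite big_ord0 subrr.
case/andP: xs => xy ys ain.
rewrite big_mkcond big_ord_recl /=.
rewrite (eq_bigr (fun i : 'I_(size s) => if nth 0 (y :: s) i < a then
  nth 0 s i - nth 0 (y :: s) i else 0)) //.
rewrite -big_mkcond /=; case: ltP => [xa|ax].
  rewrite IHs // ?subrKC //; first by lra.
  by move: ain; rewrite (gt_eqF xa).
have -> : a = x.
  apply/le_anti; rewrite ax /=; case/predU1P: ain => [->//|ain].
  apply: (le_trans xy); move: ain; rewrite inE => /predU1P[->//|].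
  exact/allP/(order_path_min le_trans).
rewrite subrr add0r big1 // => i xi; exfalso.
have := ltn_ord i => ilt.
suff : x <= nth 0 (y :: s) i by rewrite leNgt xi.
apply: (le_trans xy); have /allP := order_path_min le_trans ys.
case: i {xi} ilt => -[|i] //= _ ilt yP; apply: yP.
by rewrite mem_nth // ltnW.
Qed.

(* Insertion written with min and max, so that each entry of the sorted
   sequence is a continuous function of the entries of [s]. *)
Fixpoint minmax_insert x s : seq R :=
  if s is y :: s' then Num.min x y :: minmax_insert (Num.max x y) s'
  else [:: x].

Definition minmax_sort s : seq R := foldr minmax_insert [::] s.

Lemma minmax_insert_perm x s : perm_eq (minmax_insert x s) (x :: s).
Proof.
elim: s x => //= y s IHs x; rewrite /Num.min /Num.max; case: ifP => xy.
  by rewrite perm_cons.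
apply: (@perm_trans _ [:: y, x & s]); first by rewrite perm_cons.
by rewrite (perm_catCA [:: y] [:: x] s).
Qed.

Lemma minmax_insert_path z x s : z <= x -> path <=%R z s ->
  path <=%R z (minmax_insert x s).
Proof.
elim: s z x => [|y s IHs] z x zx /=; first by rewrite zx.
case/andP=> zy ys; rewrite le_min zx zy /=; apply: IHs.
  by rewrite ge_min le_max lexx.
case: s ys => //= u s /andP[yu ->]; rewrite andbT.
by rewrite ge_min yu orbT.
Qed.

Lemma minmax_sort_perm s : perm_eq (minmax_sort s) s.
Proof.
elim: s => //= x s IHs.
by apply: perm_trans (minmax_insert_perm x _) _; rewrite perm_cons.
Qed.

Lemma size_minmax_sort s : size (minmax_sort s) = size s.
Proof. exact: perm_size (minmax_sort_perm s). Qed.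

Lemma minmax_sort_path z s : all (>= z) s -> path <=%R z (minmax_sort s).
Proof.
by elim: s => //= x s IHs /andP[zx zs]; apply: minmax_insert_path => //;
  exact: IHs.
Qed.

(** The induction carries a list [gs] of continuous functions whose values at each [k] are the
    sorted list; inserting a function only takes pointwise minima and maxima. *)
Lemma minmax_sort_continuous (K : topologicalType) (I : Type) (r : seq I)
    (f : I -> K -> R) (k0 : K) j :
  (forall i, {for k0, continuous (f i)}) ->
  {for k0, continuous (fun k => nth 0 (minmax_sort [seq f i k | i <- r]) j)}.
Proof.
move=> cf.
have nilc i : {for k0, continuous (fun k =>
    nth 0 [seq h k | h <- Nil (K -> R)] i)}.
  by apply: cvg_near_cst; apply: nearW => k /=; rewrite !nth_nil.
have ins (g : K -> R) (fs : seq (K -> R)) : {for k0, continuous g} ->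
    (forall i, {for k0, continuous (fun k => nth 0 [seq h k | h <- fs] i)}) ->
  exists2 gs : seq (K -> R),
    (forall i, {for k0, continuous (fun k => nth 0 [seq h k | h <- gs] i)}) &
    forall k, minmax_insert (g k) [seq h k | h <- fs] = [seq h k | h <- gs].
  elim: fs g => [|h fs IHfs] g cg cfs.
    by exists [:: g] => // -[|i]; [exact: cg|exact: nilc].
  have ch := cfs 0%N.
  have [|i|gs cgs gsE] := IHfs (fun k => Num.max (g k) (h k)).
  - exact: cvgr_max.
  - exact: (cfs i.+1).
  exists ((fun k => Num.min (g k) (h k)) :: gs) => [[|i]|k] /=.
  - exact: cvgr_min.
  - exact: cgs.
  - by rewrite gsE.
suff [gs cgs gsE] : exists2 gs : seq (K -> R),
    (forall i, {for k0, continuous (fun k => nth 0 [seq h k | h <- gs] i)}) &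
    forall k, minmax_sort [seq f i k | i <- r] = [seq h k | h <- gs].
  have -> : (fun k => nth 0 (minmax_sort [seq f i k | i <- r]) j) =
      (fun k => nth 0 [seq h k | h <- gs] j) by apply: funext => k; rewrite gsE.
  exact: cgs.
elim: r => [|i r [fs cfs fsE]] /=.
  by exists [::].
have [gs cgs gsE] := ins (f i) fs (cf i) cfs.
by exists gs => // k; rewrite fsE gsE.
Qed.

End SortedSequences.

Arguments minmax_sort : simpl never.

(** * Points of simplices as subdivisions of the unit interval *)

Section SimplexRefinement.
Variable R : realType.

Lemma simplex_ge0 k (t : simplex R k) i : 0 <= set_val t i.
Proof. by have [] : simplex R k (set_val t) by exact: set_valP. Qed.

Lemma simplex_sum1 k (t : simplex R k) : \sum_i set_val t i = 1.
Proof. by have [] : simplex R k (set_val t) by exact: set_valP. Qed.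

Definition partial_mass k (t : simplex R k) (i : nat) : R :=
  \sum_(j < k.+1 | (j < i)%N) set_val t j.

Lemma partial_mass0 k (t : simplex R k) : partial_mass t 0 = 0.
Proof. by rewrite /partial_mass big1. Qed.

Lemma partial_mass_last k (t : simplex R k) : partial_mass t k.+1 = 1.
Proof.
by rewrite -(simplex_sum1 t); apply: eq_bigl => j; rewrite ltn_ord.
Qed.

Lemma partial_massS k (t : simplex R k) (i : 'I_k.+1) :
  partial_mass t i.+1 = partial_mass t i + set_val t i.
Proof.
rewrite /partial_mass (bigD1 i) ?ltnSn //= addrC; congr (_ + _).
by apply: eq_bigl => j; rewrite ltnS ltn_neqAle andbC.
Qed.

Lemma partial_mass_le k (t : simplex R k) (i j : nat) :
  (i <= j)%N -> partial_mass t i <= partial_mass t j.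
Proof.
move=> ij; rewrite /partial_mass [leRHS](bigID (fun l : 'I__ => (l < i)%N)) /=.
rewrite -[leLHS]addr0; apply: lerD; last first.
  by apply: sumr_ge0 => l _; exact: simplex_ge0.
rewrite le_eqVlt; apply/orP; left; apply/eqP; apply: eq_bigl => l.
by case: (ltnP l i) => [li|_]; rewrite ?andbT ?andbF // (leq_trans li ij).
Qed.

(** A point [t] cuts [[0, 1]] into consecutive blocks of lengths [t i]. If all block ends are among
    the cuts [0 :: s], each gap of [s] lies in one block, and [theta] sends the gap to that
    block. *)
Lemma refine_simplex k (t : simplex R k) (s : seq R) :
  path <%R 0 s -> all (<= 1) s ->
  (forall i, (i <= k.+1)%N -> partial_mass t i \in 0 :: s) ->
  exists2 theta : 'I_(size s) -> 'I_k.+1, {homo theta : i j / (i <= j)%N} &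
    forall i, \sum_(j | theta j == i) (nth 0 s j - nth 0 (0 :: s) j) =
      set_val t i.
Proof.
move=> ps s1 ts.
have ps' : path <=%R 0 s by apply: sub_path ps => a b; exact: ltW.
pose sg := nth 0 (0 :: s).
have sg0 (j : 'I_(size s)) : 0 <= sg j.
  have /allP := order_path_min le_trans ps' => s0.
  by case: j => -[|j] //= jlt; apply: s0; apply: mem_nth; exact: ltnW.
have sgS (j : 'I_(size s)) : sg j < 1.
  have := pathP 0 ps j (ltn_ord j).
  by move/lt_le_trans; apply; exact: (allP s1 _ (mem_nth _ _)).
have sg_mono (i j : 'I_(size s)) : (i <= j)%N -> sg i <= sg j.
  move=> ij.
  apply: (@sorted_leq_nth _ _ le_trans lexx 0 (0 :: s) ps') => //;
    by rewrite inE /= ltnS ltnW.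
(* The block of gap [j] is found from the left end [sg j]; half-open blocks make it unique, and
   empty blocks are skipped. *)
have thetaP (j : 'I_(size s)) : exists i : 'I_k.+1,
    partial_mass t i <= sg j < partial_mass t i.+1.
  have [|m mP mmin] := @ex_minnP (fun m => sg j < partial_mass t m).
    by exists k.+1; rewrite partial_mass_last.
  case: m => [|m] in mP mmin *.
    by move: mP; rewrite partial_mass0 ltNge sg0.
  have mk : (m < k.+1)%N.
    by apply: mmin; rewrite partial_mass_last.
  exists (Ordinal mk); rewrite mP andbT leNgt; apply/negP => /mmin.
  by rewrite ltnn.
have [theta thetaE] := choice thetaP.
have theta_lt (j : 'I_(size s)) (i : 'I_k.+1) :
    (theta j < i)%N = (sg j < partial_mass t i).
  have /andP[le_j lt_j] := thetaE j; apply/idP/idP => [ji|].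
    exact: lt_le_trans lt_j (partial_mass_le _ ji).
  apply: contraTT; rewrite -leqNgt -leNgt => ij.
  exact: le_trans (partial_mass_le _ ij) le_j.
have theta_le (j : 'I_(size s)) (i : 'I_k.+1) :
    (theta j <= i)%N = (sg j < partial_mass t i.+1).
  have /andP[le_j lt_j] := thetaE j; apply/idP/idP => [ji|].
    by apply: lt_le_trans lt_j (partial_mass_le _ _); rewrite ltnS.
  apply: contraTT; rewrite -ltnNge -leNgt => ij.
  exact: le_trans (partial_mass_le _ ij) le_j.
exists theta => [i j ij|i].
  by rewrite theta_le; have /andP[_] := thetaE j; apply/le_lt_trans/sg_mono.
have gaps m : (m <= k.+1)%N -> \sum_(j < size s | sg j < partial_mass t m)
    (nth 0 s j - sg j) = partial_mass t m.
  by move=> mk; rewrite sum_gaps ?subr0 //; exact: ts.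
(* The gaps in block [i] are those starting before its right end, minus those starting before its
   left end. *)
have := gaps i.+1 (ltn_ord i).
rewrite (bigID (fun j : 'I_(size s) => sg j < partial_mass t i)) /=.
rewrite (eq_bigl (fun j : 'I__ => sg j < partial_mass t i)); last first.
  by move=> j; rewrite -theta_lt -theta_le andbC; case: ltnP => //= /ltnW ->.
rewrite gaps; last exact: ltnW.
move=> massE; apply: (addrI (partial_mass t i)); rewrite -partial_massS -massE.
congr (_ + _); apply: eq_bigl => j.
by rewrite -theta_lt -theta_le -leqNgt -eqn_leq.
Qed.

(** Cut [[0, 1]] at the partial sums of both [t] and [u]. Removing repeated cuts makes all the gaps
    positive. *)
Lemma common_refinement k l (t : simplex R k) (u : simplex R l) :
  exists m (r : simplex R m) (theta : 'I_m.+1 -> 'I_k.+1)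
    (eta : 'I_m.+1 -> 'I_l.+1),
    [/\ {homo theta : i j / (i <= j)%N}, {homo eta : i j / (i <= j)%N},
        simplex_map theta r = t, simplex_map eta r = u
      & forall i, 0 < set_val r i].
Proof.
pose b := [seq partial_mass t i | i <- iota 0 k.+2] ++
  [seq partial_mass u i | i <- iota 0 l.+2].
have b01 x : x \in b -> 0 <= x <= 1.
  rewrite mem_cat => /orP[]/mapP[i]; rewrite mem_iota add0n => /andP[_ il] ->.
  - by rewrite -(partial_mass0 t) -(partial_mass_last t) !partial_mass_le.
  - by rewrite -(partial_mass0 u) -(partial_mass_last u) !partial_mass_le.
have tb i : (i <= k.+1)%N -> partial_mass t i \in b.
  by move=> ik; rewrite mem_cat map_f // mem_iota add0n.
have ub i : (i <= l.+1)%N -> partial_mass u i \in b.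
  by move=> ik; rewrite mem_cat orbC map_f // mem_iota add0n.
pose s0 := sort <=%R (undup b).
have s0b x : (x \in s0) = (x \in b) by rewrite mem_sort mem_undup.
have : sorted <%R s0 by rewrite sort_lt_sorted undup_uniq.
have : 0 \in s0 by rewrite s0b -(partial_mass0 t) tb.
have : 1 \in s0 by rewrite s0b -(partial_mass_last t) tb.
case: s0 s0b => [//|x s] sb s1 s0 /= ps.
have x0 : x = 0.
  apply/le_anti; have /b01/andP[-> _] : x \in b by rewrite -sb mem_head.
  move: s0; rewrite inE andbT => /predU1P[->//|].
  by move/(allP (order_path_min lt_trans ps)) => /ltW.
rewrite {}x0 in sb s1 s0 ps.
case: s sb s1 s0 ps => [|y s] sb s1 _ ps.
  by move: s1; rewrite inE oner_eq0.
have le1 : all (<= 1) (y :: s).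
  by apply/allP => z zs; have /b01/andP[] : z \in b by rewrite -sb inE zs orbT.
have [|theta htheta thetaE] := refine_simplex (t := t) ps le1.
  by move=> i ik; rewrite sb tb.
have [|eta heta etaE] := refine_simplex (t := u) ps le1.
  by move=> i ik; rewrite sb ub.
pose r : {ptws 'I_(size s).+1 -> R} :=
  fun j => nth 0 (y :: s) j - nth 0 (0 :: y :: s) j.
have r0 i : 0 < r i by rewrite subr_gt0; exact: (pathP 0 ps i (ltn_ord i)).
have rP : r \in simplex R (size s).
  apply: mem_set; split => [i|]; first exact/ltW.
  rewrite -(simplex_sum1 t) (partition_big theta xpredT) //=.
  by apply: eq_bigr => i _; rewrite -thetaE.
exists (size s), (SigSub rP), theta, eta; split=> //.
- by apply/val_inj/funext => i; exact: thetaE.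
- by apply/val_inj/funext => i; exact: etaE.
Qed.

End SimplexRefinement.

(** * Maps out of a homotopy colimit and out of its product with a compact space *)

Section HocolimLift.
Variables (R : realType) (G : topGroupType) (d : Order.disp_t).
Variables (P : porderType d) (F : gdiagram G P) (A : {pred P}).

Lemma bar_invariant (S : Type) (phi : bar R F A -> S) :
  (forall a b, bar_step a b -> phi a = phi b) ->
  forall a, phi (repr (hocolim_pi a)) = phi a.
Proof.
move=> phi_step a.
suff phi_equiv u v : clos_refl_sym_trans _ (@bar_step R _ _ _ F A) u v ->
    phi u = phi v by exact/phi_equiv/asboolP/hocolim_repr.
by elim=> {u v} [u v /phi_step|u|u v _ ->|u v w _ -> _ ->].
Qed.

Lemma hocolim_lift_continuous (S : topologicalType) (phi : bar R F A -> S) :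
  (forall a b, bar_step a b -> phi a = phi b) -> continuous phi ->
  continuous (fun x : hocolim R F A => phi (repr x)).
Proof.
move=> phi_step cphi; apply/quotient_continuous.
rewrite (_ : _ \o _ = phi) //; apply: funext => a /=.
exact: bar_invariant.
Qed.

Lemma nbhs_bar k (c : chain A k) (x : F (val c ord0)) (t : simplex R k)
    (N : set (F (val c ord0))) (M : set (simplex R k)) :
  nbhs x N -> nbhs t M -> nbhs (bar_point x t : bar R F A)
    [set a | exists y s, [/\ N y, M s & a = bar_point y s]].
Proof.
move=> Nx Mt.
have : nbhs ((x, t) : bar_piece R F (existT (chain A) k c)) (N `*` M).
  by exists (N, M).
move=> /(existT_nbhs (X := bar_piece R F (A := A))); apply: filterS.
by move=> a [[y s] [Ny Ms] <-]; exists y, s.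
Qed.

Lemma bar_continuous (S : topologicalType) (phi : bar R F A -> S) :
  (forall k (c : chain A k),
    continuous (fun xt : F (val c ord0) * simplex R k =>
      phi (bar_point xt.1 xt.2))) -> continuous phi.
Proof.
move=> cphi [[k c] [x t]] U nU.
have [[N M] /= [Nx Mt] NMU] := cphi k c (x, t) U nU.
apply: filterS (nbhs_bar Nx Mt) => a [y [s [Ny Ms ->]]].
exact: (NMU (y, s)).
Qed.

End HocolimLift.

(** A tube argument: regularity gives a neighbourhood [C] of [k0] whose closure still maps into [U].
    By compactness the set [D] of all [t] with [closure C] times [t] mapped into [U] is open, and it
    is saturated, hence the preimage of an open set of the quotient. *)
Lemma quotient_prod_continuous (K T S : topologicalType) (Q0 : quotType T)
    (g : K * quotient_topology Q0 -> S) :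
  compact [set: K] -> regular_space K ->
  continuous (fun kt : K * T => g (kt.1, \pi_(quotient_topology Q0)%qT kt.2)) ->
  continuous g.
Proof.
set pi := (\pi_(quotient_topology Q0))%qT => cK regK cg [k0 q0] U0.
rewrite nbhsE => -[U [oU Uk0] UU0].
have piK q : pi (repr q) = q by exact: reprK.
have openU k t : U (g (k, pi t)) ->
    nbhs (k, t) [set kt : K * T | U (g (kt.1, pi kt.2))].
  by move=> Ukt; apply: (cg (k, t)); exact: open_nbhs_nbhs.
have Ut0 : U (g (k0, pi (repr q0))) by rewrite piK.
have [[N M] /= [Nk0 Mt0] NM] := openU _ _ Ut0.
have [C Ck0 clC] := regK _ _ Nk0.
have cC : compact (closure C).
  by apply: (subclosed_compact _ cK) => //; exact: closed_closure.
pose D := [set t | closure C `<=` [set k | U (g (k, pi t))]].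
have oD : open D.
  rewrite openE => t Dt.
  have cv := (near_covering_withinP (closure C)).2
    ((compact_near_coveringP (closure C)).1 cC).
  apply: (cv T (nbhs t) (fun t k => U (g (k, pi t)))) => k clk.
  have [[A B] /= [Ak Bt] AB] := openU _ _ (Dt k clk).
  by exists (A, B) => // -[x y] /= [Ax By] _; exact: (AB (x, y)).
pose D' := [set q : quotient_topology Q0 | D (repr q)].
have piD' : pi @^-1` D' = D.
  by rewrite eqEsubset; split => t Dt k Ck /=; have := Dt k Ck; rewrite /= piK.
have oD' : open D' by rewrite /open/= /quotient_open piD'.
have D'q0 : nbhs q0 D'.
  apply: open_nbhs_nbhs; split => // k /clC Nk /=.
  by apply: (NM (k, repr q0)); split => //=; exact: nbhs_singleton Mt0.
exists (C, D') => // -[k q] /= [Ck Dq].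
by apply: UU0; rewrite /= -(piK q); apply: Dq; exact: subset_closure.
Qed.

(** * The unit interval and cubes: clipping, radial maps, perfect normality *)

Section UnitInterval.
Variable R : realType.
Local Notation I := (unit_interval R).

Definition clip (x : R) : R := Num.min 1 (Num.max 0 x).

Lemma clip01 x : 0 <= clip x <= 1.
Proof. by rewrite /clip le_min ge_min le_max !lexx ler01. Qed.

Lemma clip_ge1 x : 1 <= x -> clip x = 1.
Proof. by move=> x1; apply/min_idPl; rewrite le_max x1 orbT. Qed.

Lemma clip_le0 x : x <= 0 -> clip x = 0.
Proof. by move=> x0; rewrite /clip (max_idPl x0) (min_idPr ler01). Qed.

Lemma clip_id x : 0 <= x <= 1 -> clip x = x.
Proof. by case/andP=> x0 x1; rewrite /clip (max_idPr x0) (min_idPr x1). Qed.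

Lemma cvg_clip (S : Type) (F : set_system S) {FF : Filter F} (f : S -> R) a :
  f x @[x --> F] --> a -> clip (f x) @[x --> F] --> clip a.
Proof.
by move=> fa; apply: cvgr_min; [exact: cvg_cst|
  apply: cvgr_max => //; exact: cvg_cst].
Qed.

Lemma unit_intervalP (x : R) : 0 <= x <= 1 -> x \in (`[0, 1]%classic : set R).
Proof. by move=> x01; apply: mem_set; rewrite /= in_itv. Qed.

Definition to_unit (x : R) : I := SigSub (unit_intervalP (clip01 x)).

Lemma unit_ge0 (u : I) : 0 <= set_val u.
Proof. by have := set_valP u; rewrite /= in_itv /= => /andP[]. Qed.

Lemma unit_le1 (u : I) : set_val u <= 1.
Proof. by have := set_valP u; rewrite /= in_itv /= => /andP[]. Qed.

Lemma to_unitK (u : I) : to_unit (set_val u) = u.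
Proof. by apply: val_inj; rewrite /= clip_id // unit_ge0 unit_le1. Qed.

Lemma cvg_to_unit (S : Type) (F : set_system S) {FF : Filter F} (f : S -> R) a :
  f x @[x --> F] --> a -> to_unit (f x) @[x --> F] --> to_unit a.
Proof. by move=> fa; apply: cvg_subtype; exact: cvg_clip. Qed.

Lemma unit_interval_compact : compact [set: I].
Proof.
have -> : [set: I] = to_unit @` `[0, 1].
  by rewrite eqEsubset; split => // u _; exists (set_val u);
    [exact: set_valP|exact: to_unitK].
apply: continuous_compact; last exact: segment_compact.
by apply: continuous_subspaceT => x; exact: cvg_to_unit.
Qed.

Lemma unit_interval_hausdorff : hausdorff_space I.
Proof.
move=> u v uv; apply/val_inj/(@Rhausdorff R) => B C Bu Cv.
have [x [Bx Cx]] := uv _ _ (@set_val_continuous _ _ u B Bu)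
  (@set_val_continuous _ _ v C Cv).
by exists (set_val x).
Qed.

Lemma unit_interval_regular : regular_space I.
Proof.
move=> u; apply: (compact_regular unit_interval_hausdorff unit_interval_compact).
exact: filterT.
Qed.

End UnitInterval.

Section Cube.
Variables (R : realType) (k : nat).
Local Notation cube := (cube R k).
Implicit Types s t : cube.

Lemma cvg_cube_coord (S : Type) (F : set_system S) {FF : Filter F} (f : S -> cube)
    s i : f x @[x --> F] --> s -> set_val (f x i) @[x --> F] --> set_val (s i).
Proof.
move=> fs; apply: (@cvg_comp _ _ _ (fun x => f x i) (@set_val _ _) _ (nbhs (s i))).
  apply: (@cvg_comp _ _ _ f (fun t : cube => t i) _ (nbhs s)) => //.
  exact: ptws_proj_continuous.
exact: set_val_continuous.
Qed.

(** Twice the sup-distance to the centre of the cube, so that the boundary is the unit sphere; it is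
    [0] on the cube of dimension zero. *)
Definition cube_norm s : R := \big[Num.max/0]_i `|2 * set_val (s i) - 1|.

Lemma cvg_cube_norm (S : Type) (F : set_system S) {FF : Filter F} (f : S -> cube) s :
  f x @[x --> F] --> s -> cube_norm (f x) @[x --> F] --> cube_norm s.
Proof.
move=> fs; apply: (@cvgr_bigmax R S F _ _ _ _
  (fun i x => `|2 * set_val (f x i) - 1|)
  (fun i => `|2 * set_val (s i) - 1|)) => i _.
apply: cvg_norm; apply: cvgB; last exact: cvg_cst.
by apply: cvgM; [exact: cvg_cst|exact: cvg_cube_coord].
Qed.

Lemma cube_norm_ge s i : `|2 * set_val (s i) - 1| <= cube_norm s.
Proof. exact: (le_bigmax_cond 0 (fun i => `|2 * set_val (s i) - 1|)). Qed.

Lemma unit_norm_le1 (u : unit_interval R) : `|2 * set_val u - 1| <= 1.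
Proof. by rewrite ler_norml; have := unit_ge0 u; have := unit_le1 u; lra. Qed.

Lemma cube_norm_le1 s : cube_norm s <= 1.
Proof. by apply: bigmax_le => [|i _]; [exact: ler01|exact: unit_norm_le1]. Qed.

(** Positivity rules out that the maximum is its default value [0] alone. *)
Lemma cube_norm_attained s : 0 < cube_norm s ->
  exists i, cube_norm s = `|2 * set_val (s i) - 1|.
Proof.
move=> n0; apply: contrapT => h.
suff : cube_norm s < cube_norm s by rewrite ltxx.
apply: bigmax_lt => // i _; rewrite lt_neqAle cube_norm_ge andbT.
by apply/eqP => si; apply: h; exists i.
Qed.

Lemma cube_bdryE s : cube_bdry s <-> cube_norm s = 1.
Proof.
split=> [[i si]|n1].
  apply/le_anti; rewrite cube_norm_le1 /=; apply: le_trans (cube_norm_ge s i).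
  by case: si => ->; rewrite ?mulr0 ?mulr1 ?sub0r ?normrN ?normr1 // addrK normr1.
have [|i] := @cube_norm_attained s; rewrite n1 ?ltr01 // => /esym h.
exists i; move: h; have := unit_ge0 (s i); have := unit_le1 (s i).
by case: ler0P => _ *; [left|right]; lra.
Qed.

(* Radial expansion about the centre by the factor [1 / c], followed by the
   radial retraction onto the boundary. *)
Definition radial (c : R) (s : cube) : cube := fun i =>
  to_unit (1 / 2 + (set_val (s i) - 1 / 2) / Num.max c (cube_norm s)).

Lemma radialE c s i : 0 < c -> set_val (radial c s i) =
  1 / 2 + (set_val (s i) - 1 / 2) / Num.max c (cube_norm s).
Proof.
move=> c0; rewrite [LHS](_ : _ = clip (1 / 2 + (set_val (s i) - 1 / 2) /
  Num.max c (cube_norm s))) // clip_id //.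
set M := Num.max _ _; have M0 : 0 < M by rewrite lt_max c0.
have : `|2 * set_val (s i) - 1| <= M by rewrite le_max cube_norm_ge orbT.
rewrite ler_norml => /andP[h1 h2].
have : - (1 / 2) <= (set_val (s i) - 1 / 2) / M <= 1 / 2.
  by rewrite ler_pdivlMr // ler_pdivrMr //; lra.
lra.
Qed.

Lemma cvg_radial (S : Type) (F : set_system S) {FF : Filter F} (f : S -> R)
    (g : S -> cube) (c : R) s : 0 < c -> f x @[x --> F] --> c ->
  g x @[x --> F] --> s -> radial (f x) (g x) @[x --> F] --> radial c s.
Proof.
move=> c0 fc gs; apply: cvg_ptws => i; apply: cvg_to_unit.
apply: cvgD; first exact: cvg_cst.
apply: cvgM; first by apply: cvgB; [exact: cvg_cube_coord|exact: cvg_cst].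
apply: cvgV; first by rewrite gt_eqF // lt_max c0.
by apply: cvgr_max => //; exact: cvg_cube_norm.
Qed.

Lemma radial1 s : radial 1 s = s.
Proof.
apply: funext => i; apply/val_inj; rewrite -[LHS]/(set_val _) radialE //.
by rewrite (max_idPl (cube_norm_le1 s)) divr1 subrKC.
Qed.

Lemma radial_bdry c s : c <= 1 -> cube_norm s = 1 -> radial c s = s.
Proof.
by move=> c1 s1; rewrite -[RHS]radial1 /radial s1 (max_idPr c1) maxxx.
Qed.

Lemma radial_to_bdry s : 1 / 2 <= cube_norm s -> cube_norm (radial (1 / 2) s) = 1.
Proof.
move=> n2; have n0 : 0 < cube_norm s by lra.
have [i iE] := cube_norm_attained n0.
apply/le_anti; rewrite cube_norm_le1 /=.
apply: le_trans (cube_norm_ge _ i); rewrite radialE; last by lra.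
rewrite (max_idPr n2).
have -> : 2 * (1 / 2 + (set_val (s i) - 1 / 2) / cube_norm s) - 1 =
    (2 * set_val (s i) - 1) / cube_norm s by field; rewrite gt_eqF.
by rewrite normrM -iE normfV gtr0_norm // divff // gt_eqF.
Qed.

Definition cube_dist s t : R := \sum_i `|set_val (s i) - set_val (t i)|.

Lemma cube_dist_ge0 s t : 0 <= cube_dist s t.
Proof. by apply: sumr_ge0. Qed.

Lemma cube_distxx s : cube_dist s s = 0.
Proof. by rewrite /cube_dist big1 // => i _; rewrite subrr normr0. Qed.

Lemma cube_distC s t : cube_dist s t = cube_dist t s.
Proof. by apply: eq_bigr => i _; rewrite distrC. Qed.

Lemma cube_dist_triangle s t u : cube_dist s u <= cube_dist s t + cube_dist t u.
Proof. by rewrite -big_split; apply: ler_sum => i _; exact: ler_distD. Qed.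

Lemma nbhs_cube_dist s (U : set cube) : nbhs s U ->
  exists2 e : R, 0 < e & forall t, cube_dist s t < e -> U t.
Proof.
(* The filter of balls about [s] converges to [s] because it does so in each coordinate; hence every
   neighbourhood of [s] contains a ball. *)
pose F := filter_from [set e : R | 0 < e] (fun e => [set t | cube_dist s t < e]).
have FF : Filter F.
  apply: filter_from_filter; first by exists 1 => /=.
  move=> e e' /= e0 e'0; exists (Num.min e e'); first by rewrite /= lt_min e0.
  by move=> t /=; rewrite lt_min => /andP[].
suff Fs : (fun t : cube => t) t @[t --> F] --> s.
  by move=> /Fs [e e0 eU]; exists e => // t; exact: eU.
apply: cvg_ptws => i; apply: cvg_subtype; apply/cvgrPdist_lt => e e0.
exists e => // t /=; apply: le_lt_trans.
by rewrite /cube_dist (bigD1 i) //= lerDl sumr_ge0.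
Qed.

(** The function is the distance to the complement of [U], truncated at [1] so that the infimum is
    over a nonempty set even if [U] is the whole cube. It is 1-Lipschitz. *)
Lemma cube_cozero (U : set cube) : open U -> exists2 h : cube -> R, continuous h &
  forall s, 0 <= h s /\ (0 < h s <-> U s).
Proof.
move=> oU; pose D s := [set e : R | e = 1 \/ exists2 t, ~ U t & e = cube_dist s t].
have D0 s : lbound (D s) 0.
  by move=> _ [->|[t _ ->]]; [exact: ler01|exact: cube_dist_ge0].
have infD s e : D s e -> inf (D s) <= e by apply: ge_inf; exists 0; exact: D0.
have le_infD s e : lbound (D s) e -> e <= inf (D s).
  by apply: lb_le_inf; exists 1; left.
have lip s t : inf (D s) - inf (D t) <= cube_dist s t.
  rewrite lerBlDr -lerBlDl; apply: le_infD => _ [->|[u Uu ->]].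
    have := infD s 1 (or_introl erefl); have := cube_dist_ge0 s t; lra.
  have := infD s (cube_dist s u) (or_intror (ex_intro2 _ _ u Uu erefl)).
  have := cube_dist_triangle s t u; lra.
exists (fun s => inf (D s)) => [s|s].
  apply/(@cvgrPdist_lt _ _ _ (nbhs s) (nbhs_filter s)) => e e0.
  have cdist : cube_dist s t @[t --> s] --> cube_dist s s.
    apply: (@cvgr_sum R cube (nbhs s) _ _ _ _
      (fun i t => `|set_val (s i) - set_val (t i)|)
      (fun i => `|set_val (s i) - set_val (s i)|)) => i _.
    apply: cvg_norm; apply: cvgB; first exact: cvg_cst.
    exact: (@cvg_cube_coord cube (nbhs s) (nbhs_filter s) id s i).
  have near_e : \forall t \near s, cube_dist s t < e.
    by apply: (cvgr_lt _ cdist); rewrite cube_distxx.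
  near=> t; apply: (@le_lt_trans _ _ (cube_dist s t)); last by near: t.
  rewrite ler_norml lip andbT lerNl opprB cube_distC; exact: lip.
split; first exact/le_infD/D0.
split=> [h0|Us].
  apply: contrapT => NUs; have : inf (D s) <= 0.
    by apply: infD; right; exists s => //; rewrite cube_distxx.
  by rewrite leNgt h0.
have [e e0 eU] := nbhs_cube_dist (open_nbhs_nbhs (conj oU Us)).
apply: (@lt_le_trans _ _ (Num.min 1 e)); first by rewrite lt_min ltr01.
apply: le_infD => _ [->|[t NUt ->]]; rewrite ge_min ?lexx //.
by apply/orP; right; rewrite leNgt; apply/negP => /eU.
Unshelve. all: by end_near. Qed.

End Cube.

(** * Coordinates on a homotopy colimit indexed by subsets of a finite set *)

Section Coordinates.
Variables (R : realType) (G : topGroupType) (d : Order.disp_t).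
Variables (P : finPOrderType d) (F : gdiagram G P) (A : {pred P}).
Variables (T : finType) (lab : P -> {set T}) (ample : pred {set T}).
Variables (Z : topologicalType) (V : T -> set Z) (emb : forall p, F p -> Z).
Arguments emb {p} _.

(** The setting: [P] is a poset of subsets of [T] under reverse inclusion, and [F p] is the
    intersection of the open sets [V s], [s] in [lab p], with the subspace topology of [Z]. A set of
    labels must come from [P] only if the corresponding [V s] have a common point. *)
Hypothesis lab_le : forall p q, (p <= q)%O = (lab q \subset lab p).
Hypothesis lab_ample : forall p, (p \in A) = ample (lab p).
Hypothesis ampleS : forall S S' : {set T},
  S \subset S' -> ample S -> ample S'.
Hypothesis V_open : forall s, open (V s).
Hypothesis emb_range : forall p z,
  (exists x : F p, emb x = z) <-> (forall s, s \in lab p -> V s z).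
Hypothesis emb_dmap : forall p q (pq : (p <= q)%O) (x : F p),
  emb (dmap F pq x) = emb x.
Hypothesis emb_inj : forall p, injective (@emb p).
Hypothesis emb_continuous : forall p, continuous (@emb p).
Hypothesis emb_initial : forall p (x : F p) N, nbhs x N ->
  exists2 M, nbhs (emb x) M & forall y : F p, M (emb y) -> N y.
Hypothesis lab_onto : forall z (S : {set T}),
  (forall s, s \in S -> V s z) -> exists p, lab p = S.

Local Notation E := (hocolim R F A).

Definition bar_coord (s : T) (a : bar R F A) : R :=
  let: existT (existT k c) xt := a in
  \sum_(i | s \in lab (val c i)) set_val xt.2 i.

Definition bar_base (a : bar R F A) : Z :=
  let: existT (existT k c) xt := a in emb xt.1.

Lemma bar_coord_step s a b : bar_step a b -> bar_coord s a = bar_coord s b.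
Proof.
case=> k m c theta htheta x t /=.
rewrite [RHS](partition_big theta (fun i => s \in lab (val c i))) /=.
  apply: eq_bigr => i si; apply: eq_bigl => j.
  by rewrite ffunE; case: eqP => [->|_]; rewrite ?andbF // si.
by move=> j; rewrite ffunE.
Qed.

Lemma bar_base_step a b : bar_step a b -> bar_base a = bar_base b.
Proof. by case=> k m c theta htheta x t /=; rewrite emb_dmap. Qed.

Lemma simplex_coord_continuous k i :
  continuous (fun t : simplex R k => set_val t i : R).
Proof.
move=> t; apply: (@continuous_comp _ _ _ (@set_val _ (simplex R k))
  (fun t : {ptws 'I_k.+1 -> R} => t i)); first exact: set_val_continuous.
exact: ptws_proj_continuous.
Qed.

Lemma bar_coord_continuous s : continuous (bar_coord s).
Proof.
apply: bar_continuous => k c xt /=; apply: cvgr_sum => i _.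
apply: (@continuous_comp _ _ _ snd (fun t : simplex R k => set_val t i)).
  exact: cvg_snd.
exact: simplex_coord_continuous.
Qed.

Lemma bar_base_continuous : continuous bar_base.
Proof.
apply: bar_continuous => k c xt /=.
by apply: continuous_comp; [exact: cvg_fst|exact: emb_continuous].
Qed.

Definition coord (s : T) (e : E) : R := bar_coord s (repr e).
Definition base (e : E) : Z := bar_base (repr e).

Lemma coordE s a : coord s (hocolim_pi a) = bar_coord s a.
Proof. exact: (bar_invariant (bar_coord_step s)). Qed.

Lemma baseE a : base (hocolim_pi a) = bar_base a.
Proof. exact: (bar_invariant bar_base_step). Qed.

Lemma coord_continuous s : continuous (coord s).
Proof.
apply: hocolim_lift_continuous; last exact: bar_coord_continuous.
exact: bar_coord_step.
Qed.

Lemma base_continuous : continuous base.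
Proof.
apply: hocolim_lift_continuous; last exact: bar_base_continuous.
exact: bar_base_step.
Qed.

(** The image of the homotopy colimit under base point and coordinates: necessity is
    [admissible_coord], sufficiency is [admissible_ex]. *)
Definition admissible (z : Z) (w : T -> R) :=
  [/\ forall s, 0 <= w s <= 1, forall s, 0 < w s -> V s z
    & ample [set s | w s == 1]%SET].

Lemma chain_lab k (c : chain A k) (i j : 'I_k.+1) :
  (i <= j)%N -> lab (val c j) \subset lab (val c i).
Proof. by move=> ij; rewrite -lab_le chain_le. Qed.

Lemma bar_coord_gt0 s k (c : chain A k) (x : F (val c ord0))
  (t : simplex R k) : 0 < bar_coord s (bar_point x t) -> s \in lab (val c ord0).
Proof.
move=> /=; apply: contraTT => sc; rewrite -leNgt big1 // => i si.
by case/negP: sc; apply: fintype.subsetP si; exact: chain_lab.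
Qed.

Lemma admissible_coord e : admissible (base e) (coord^~ e).
Proof.
elim/hocolim_ind: e => -[[k c] [x t]].
have wE s : coord s (hocolim_pi (bar_point x t)) =
  \sum_(i | s \in lab (val c i)) set_val t i by rewrite coordE.
split=> [s|s|].
- rewrite wE sumr_ge0 /= => [|i _]; last exact: simplex_ge0.
  rewrite -(simplex_sum1 t) [leRHS](bigID (fun i => s \in lab (val c i))) /=.
  by rewrite lerDl sumr_ge0 // => i _; exact: simplex_ge0.
- rewrite coordE => /bar_coord_gt0 sc; rewrite baseE /=.
  by apply: (emb_range _ _).1 sc; exists x.
(* Labels decrease along a chain, so an element of the last label lies in all of them and gets the
   total weight [1]. *)
- apply: (@ampleS (lab (val c ord_max))); last by rewrite -lab_ample chain_in.
  apply/fintype.subsetP => s sc; rewrite inE wE -(simplex_sum1 t).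
  rewrite [X in X == _](eq_bigl xpredT) // => i.
  by apply: fintype.subsetP sc; apply: chain_lab; rewrite -ltnS.
Qed.

(* With positive weights the chain consists of superlevel sets of the
   coordinates, so that it is determined by them. *)
Lemma chain_superlevel k (c : chain A k) (t : simplex R k) j s :
  (forall i, 0 < set_val t i) ->
  (s \in lab (val c j)) =
    (partial_mass t j < \sum_(i | s \in lab (val c i)) set_val t i).
Proof.
move=> t0; apply/idP/idP => [sj|].
  apply: (@lt_le_trans _ _ (partial_mass t j.+1)).
    by rewrite partial_massS ltrDl.
  rewrite /partial_mass [leRHS](bigID (fun i : 'I__ => (i < j.+1)%N)) /=.
  rewrite -[leLHS]addr0; apply: lerD; last by apply: sumr_ge0 => i _; exact/ltW.
  rewrite le_eqVlt; apply/orP; left; apply/eqP; apply: eq_bigl => i.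
  rewrite ltnS; case: leqP => [ij|_]; rewrite ?andbF // andbT; symmetry.
  by apply: fintype.subsetP sj; exact: chain_lab.
apply: contraTT => sj; rewrite -leNgt /partial_mass.
rewrite [leRHS](bigID (fun i => s \in lab (val c i))) /=.
rewrite -[leLHS]addr0; apply: lerD; last by apply: sumr_ge0 => i _; exact/ltW.
rewrite le_eqVlt; apply/orP; left; apply/eqP; apply: eq_bigl => i.
case: (boolP (s \in _)) => [si|_]; rewrite ?andbF // andbT; symmetry.
rewrite ltnNge; apply: contra sj => ji; apply: fintype.subsetP si; exact: chain_lab.
Qed.

Lemma bar_point_eq k (c c' : chain A k) (x : F (val c ord0))
    (x' : F (val c' ord0)) (t : simplex R k) :
  c = c' -> emb x = emb x' -> bar_point x t = bar_point x' t.
Proof. by move=> cc'; case: c' / cc' x' => x' /emb_inj ->. Qed.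

(** Move both representatives to a common refinement, where the weights are equal and positive.
    There the coordinates determine the labels of the chain by [chain_superlevel], hence the chain,
    and [emb_inj] gives the point. *)
Lemma coord_inj e e' : base e = base e' -> coord^~ e =1 coord^~ e' -> e = e'.
Proof.
elim/hocolim_ind: e => -[[k c] [x t]]; elim/hocolim_ind: e' => -[[l c'] [x' u]].
rewrite !baseE /= => xx' tu.
have {}tu s : \sum_(i | s \in lab (val c i)) set_val t i =
  \sum_(i | s \in lab (val c' i)) set_val u i.
  by have := tu s; rewrite !coordE.
have [m [r [theta [eta [htheta heta tE uE r0]]]]] := common_refinement t u.
have stepl := @BarStep R _ _ _ F A _ _ c theta htheta x r.
have stepr := @BarStep R _ _ _ F A _ _ c' eta heta x' r.
rewrite tE in stepl; rewrite uE in stepr.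
have -> : hocolim_pi (existT (bar_piece R F (A:=A)) (existT (chain A) k c) (x, t))
  = hocolim_pi (bar_point (dmap F (chain_comp_ge c htheta) x) r).
  by apply: hocolim_pi_eq; apply/asboolP; exact: rst_step.
have -> : hocolim_pi (existT (bar_piece R F (A:=A)) (existT (chain A) l c') (x', u))
  = hocolim_pi (bar_point (dmap F (chain_comp_ge c' heta) x') r).
  by apply: hocolim_pi_eq; apply/asboolP; exact: rst_step.
congr hocolim_pi; apply: bar_point_eq; last by rewrite !emb_dmap.
apply/val_inj/ffunP => j.
suff labE : lab (val (chain_comp c htheta) j) = lab (val (chain_comp c' heta) j).
  by apply/le_anti; rewrite !lab_le labE subxx.
apply/finset.setP => s; rewrite !(chain_superlevel _ _ _ r0).
have /= := bar_coord_step s stepl; have /= := bar_coord_step s stepr.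
by rewrite tu => -> ->.
Qed.

(* The weights are the gaps of [0 :: thresholds w]; its initial zero gap makes
   room for an arbitrary first element of the chain. *)
Definition thresholds (w : T -> R) : seq R :=
  0 :: minmax_sort (1 :: [seq w s | s <- enum T]).

Definition gap (w : T -> R) (i : nat) : R :=
  nth 0 (thresholds w) i - nth 0 (0 :: thresholds w) i.

Section Thresholds.
Variable w : T -> R.
Hypothesis w01 : forall s, 0 <= w s <= 1.

Lemma size_thresholds : size (thresholds w) = #|T|.+2.
Proof. by rewrite /thresholds /= size_minmax_sort /= size_map -cardE. Qed.

Lemma thresholds_path : path <=%R 0 (thresholds w).
Proof.
rewrite /thresholds /= lexx; apply: minmax_sort_path; rewrite /= ler01 /=.
by apply/allP => _ /mapP[s _ ->]; case/andP: (w01 s).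
Qed.

Lemma mem_thresholds a :
  a \in thresholds w = [|| a == 0, a == 1 | [exists s, a == w s]].
Proof.
rewrite /thresholds in_cons (perm_mem (minmax_sort_perm _)) in_cons.
congr [|| _, _ | _]; apply/mapP/existsP => [[s _ ->]|[s /eqP ->]].
  by exists s.
by exists s; rewrite ?mem_enum.
Qed.

Lemma thresholds_le i j : (i <= j)%N -> (j < #|T|.+3)%N ->
  nth 0 (0 :: thresholds w) i <= nth 0 (0 :: thresholds w) j.
Proof.
have size3 : size (0 :: thresholds w) = #|T|.+3 by exact: congr1 size_thresholds.
move=> ij jT; apply: (@sorted_leq_nth _ _ le_trans lexx 0 (0 :: thresholds w)
  thresholds_path) => //; rewrite inE size3 //.
exact: leq_ltn_trans jT.
Qed.

Lemma thresholds_ge0 i : (i < #|T|.+3)%N -> 0 <= nth 0 (0 :: thresholds w) i.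
Proof. exact: (@thresholds_le 0). Qed.

Lemma thresholds_le1 i : nth 0 (thresholds w) i <= 1.
Proof.
case: (ltnP i (size (thresholds w))) => [ilt|ige]; last first.
  by rewrite nth_default // ler01.
have := mem_nth 0 ilt; rewrite mem_thresholds => /or3P[/eqP->|/eqP->|] //.
by move=> /existsP[s /eqP ->]; case/andP: (w01 s).
Qed.

Lemma gap_ge0 i : (i < #|T|.+2)%N -> 0 <= gap w i.
Proof. by move=> iT; rewrite subr_ge0 (@thresholds_le i i.+1). Qed.

Lemma sum_gap_lt a : a \in thresholds w ->
  \sum_(i < #|T|.+2 | nth 0 (0 :: thresholds w) i < a) gap w i = a.
Proof.
move=> aw; rewrite -[RHS]subr0 -(sum_gaps thresholds_path) ?size_thresholds //.
by rewrite inE aw orbT.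
Qed.

Lemma sum_gap : \sum_(i < #|T|.+2) gap w i = 1.
Proof.
rewrite (bigID (fun i : 'I__ => nth 0 (0 :: thresholds w) i < 1)) /=.
rewrite sum_gap_lt ?mem_thresholds ?eqxx ?orbT // big1 ?addr0 // => i.
rewrite -leNgt => le1; apply/le_anti; rewrite gap_ge0 // andbT subr_le0.
exact: le_trans (thresholds_le1 _) le1.
Qed.

Lemma gap_simplex : ((fun i => gap w i) : {ptws 'I_#|T|.+2 -> R}) \in
  simplex R #|T|.+1.
Proof. by apply: mem_set; split=> [i|]; [exact: gap_ge0|exact: sum_gap]. Qed.

End Thresholds.

(** The chain of superlevel sets of [w], with its first member replaced by [q]. The first gap is
    zero, so the choice of [q] does not affect the coordinates. *)
Lemma threshold_chain z w q : admissible z w ->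
  (forall s, 0 < w s -> s \in lab q) ->
  exists c : chain A #|T|.+1, val c ord0 = q /\
    forall s, \sum_(i | s \in lab (val c i)) gap w i = w s.
Proof.
move=> [w01 wV wA] wq.
(* The clause [w s == 1] keeps the set ample once the threshold has reached [1], where the strict
   superlevel set is empty. *)
pose level i := [set s | (w s == 1) || (nth 0 (0 :: thresholds w) i < w s)]%SET.
have level_gt0 i s : (i < #|T|.+3)%N -> s \in level i -> 0 < w s.
  move=> iT; rewrite inE => /orP[/eqP->//|].
  exact/le_lt_trans/thresholds_ge0.
have ex_p (i : 'I_#|T|.+2) : exists p, lab p = level i.
  apply: (@lab_onto z) => s si; apply: wV; apply: level_gt0 si.
  exact: leqW.
have [p pE] := choice ex_p.
pose c := [ffun i : 'I_#|T|.+2 => if i == ord0 then q else p i].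
have levelq (i : 'I_#|T|.+2) : level i \subset lab q.
  by apply/fintype.subsetP => s si; apply: wq; apply: level_gt0 si; exact: leqW.
have chainc : is_chain A c.
  apply/andP; split; apply/forallP => i.
    rewrite ffunE lab_ample; apply: (ampleS _ wA).
    case: eqP => [_|_]; last first.
      by rewrite pE; apply/fintype.subsetP => s; rewrite !inE => ->.
    by apply/fintype.subsetP => s; rewrite inE => /eqP ws; apply: wq; rewrite ws.
  apply/forallP => j; apply/implyP => ij; rewrite lab_le !ffunE.
  case: (i =P ord0) => [i0|i0].
    by case: (j =P ord0) => _; rewrite ?pE.
  case: (j =P ord0) => [j0|_].
    by exfalso; apply: i0; apply/val_inj/eqP; rewrite -leqn0; move: ij; rewrite j0.
  rewrite !pE; apply/fintype.subsetP => s; rewrite !inE => /orP[->//|ws].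
  rewrite (le_lt_trans _ ws) ?orbT //; apply: thresholds_le => //.
  exact: leqW.
exists (exist (fun b => is_true (is_chain A b)) c chainc); split.
  by rewrite /= ffunE eqxx.
move=> s /=; case: (eqVneq (w s) 1) => ws.
  rewrite ws -[RHS](sum_gap w01) (eq_bigl xpredT) // => i; rewrite ffunE.
  by case: eqP => _; [apply: wq; rewrite ws|rewrite pE inE ws eqxx].
rewrite -[RHS](sum_gap_lt w01); last first.
  by rewrite mem_thresholds // (_ : [exists _, _]) ?orbT //; apply/existsP; exists s.
rewrite [LHS]big_mkcond [RHS]big_mkcond; apply: eq_bigr => i _.
rewrite ffunE; case: eqP => [->|_]; last by rewrite pE inE (negbTE ws).
by rewrite /gap /= subrr !if_same.
Qed.

Lemma admissible_ex z w : admissible z w ->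
  exists e : E, base e = z /\ coord^~ e =1 w.
Proof.
move=> zw; have [w01 wV wA] := zw.
have [q qE] : exists q, lab q = [set s | 0 < w s]%SET.
  by apply: (@lab_onto z) => s; rewrite inE; exact: wV.
have [|c [cq cw]] := threshold_chain (q := q) zw.
  by move=> s ws; rewrite qE inE.
have [x xz] : exists x : F (val c ord0), emb x = z.
  by apply/emb_range => s; rewrite cq qE inE; exact: wV.
exists (hocolim_pi (bar_point x (SigSub (gap_simplex w01) : simplex R _))).
by split=> [|s]; rewrite ?baseE ?coordE //= cw.
Qed.

(** * Continuity of maps into the homotopy colimit, and relative lifting *)

Lemma near_V (K : topologicalType) (f : K -> Z) (k0 : K) s :
  {for k0, continuous f} -> V s (f k0) -> \forall k \near k0, V s (f k).
Proof. by move=> cf Vs; apply: cf; exact: open_nbhs_nbhs. Qed.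

(* The topology of the homotopy colimit is finer than that induced by the
   coordinates; near a point where the chains below may all be taken to start at
   the same [q] there is no difference. *)
Lemma lift_continuous_at (K : topologicalType) (l : K -> E) (k0 : K) (q : P) :
  {for k0, continuous (fun k => base (l k))} ->
  (forall s, {for k0, continuous (fun k => coord s (l k))}) ->
  (forall s, s \in lab q -> V s (base (l k0))) ->
  (\forall k \near k0, forall s, 0 < coord s (l k) -> s \in lab q) ->
  {for k0, continuous l}.
Proof.
move=> cb cc Vq nq O nO.
have w01 k : forall s, 0 <= coord s (l k) <= 1 by have [] := admissible_coord (l k).
pose t k : simplex R #|T|.+1 := SigSub (gap_simplex (w01 k)).
have cgap i : {for k0, continuous (fun k => gap (coord^~ (l k)) i)}.
  have csort j : {for k0, continuous (fun k =>
      nth 0 (minmax_sort (1 :: [seq coord s (l k) | s <- enum T])) j)}.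
    (* [None] indexes the constant entry [1] of the sorted list. *)
    have := @minmax_sort_continuous R K (option T) (None :: map Some (enum T))
      (fun o k => if o is Some s then coord s (l k) else 1) k0 j.
    rewrite (_ : (fun k => _) = (fun k =>
      nth 0 (minmax_sort (1 :: [seq coord s (l k) | s <- enum T])) j)).
      by apply=> -[s|]; [exact: cc|exact: cvg_cst].
    by apply: funext => k /=; rewrite -map_comp.
  apply: cvgB; first by case: i => [|i]; [exact: cvg_cst|exact: csort].
  by case: i => [|[|i]]; [exact: cvg_cst|exact: cvg_cst|exact: csort].
have ct : {for k0, continuous t}.
  by apply: cvg_subtype; apply: cvg_ptws => i; exact: cgap.
have nV : \forall k \near k0, forall s, s \in lab q -> V s (base (l k)).
  apply: filter_forall => s; case: (boolP (s \in lab q)) => [sq|_].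
    by apply: filterS (near_V cb (Vq s sq)).
  exact: nearW.
pose good (c : chain A #|T|.+1) k := val c ord0 = q /\
  forall s, \sum_(i | s \in lab (val c i)) set_val (t k) i = coord s (l k).
(* There are finitely many chains of this length, and near [k0] some chain is good for [l k], so
   they can be treated one by one. A chain whose weight sums match at [k0] represents [l] near [k0],
   when good, by continuous data in a single piece; any other chain stays bad near [k0]. *)
have Oc (c : chain A #|T|.+1) : \forall k \near k0, good c k -> O (l k).
  have [cq|cq] := pselect (val c ord0 = q); last by apply: nearW => k [].
  have [x0 x0E] : exists x : F (val c ord0), emb x = base (l k0).
    by apply/emb_range; rewrite cq.
  (* The default [x0] can be taken only where [base (l k)] leaves some [V s], [s] in [lab q], which
     does not happen near [k0]. *)
  pose x k := xget x0 [set x | emb x = base (l k)].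
  have xE k : (forall s, s \in lab q -> V s (base (l k))) ->
      emb (x k) = base (l k).
    move=> Vk; have [y yE] : exists y : F (val c ord0), emb y = base (l k).
      by apply/emb_range; rewrite cq.
    exact: (@xgetI _ x0 [set x | emb x = base (l k)] y).
  have cx : {for k0, continuous x}.
    move=> N /emb_initial[M Mx MN].
    have /cb Mk : nbhs (base (l k0)) M by rewrite -xE.
    suff : \forall k \near k0, N (x k) by [].
    near=> k; apply: MN; rewrite xE; last by near: k.
    by near: k.
  have [tk0|] := pselect
      (forall s, \sum_(i | s \in lab (val c i)) set_val (t k0) i = coord s (l k0)).
    have lk0 : l k0 = hocolim_pi (bar_point (x k0) (t k0)).
      by apply: coord_inj => [|s]; rewrite ?baseE ?coordE //= ?xE ?tk0.
    have : nbhs (bar_point (x k0) (t k0)) (@hocolim_pi R _ _ _ F A @^-1` O).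
      by apply: hocolim_pi_continuous; rewrite -lk0.
    move=> /(@existT_continuous _ (bar_piece R F (A := A))
      (existT (chain A) _ c) (x k0, t k0)) [[N M] /= [Nx Mt] NMO].
    near=> k => -[_ tk].
    have -> : l k = hocolim_pi (bar_point (x k) (t k)).
      apply: coord_inj => [|s]; rewrite ?baseE ?coordE //= ?xE //.
      by near: k.
    by apply: (NMO (x k, t k)); split => /=; near: k; [exact: cx|exact: ct].
  move=> /existsNP[s /eqP]; rewrite -subr_eq0 => ts.
  have cs : {for k0, continuous (fun k =>
      \sum_(i | s \in lab (val c i)) set_val (t k) i - coord s (l k))}.
    apply: cvgB; last exact: cc.
    by apply: (@cvgr_sum R K (nbhs k0) _ _ _ _ (fun i k => set_val (t k) i)
      (fun i => set_val (t k0) i)) => i _; exact: cgap.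
  have nts := cvgr_neq0 _ cs ts.
  near=> k => -[_ tk].
  suff /eqP[] : \sum_(i | s \in lab (val c i)) set_val (t k) i - coord s (l k) != 0.
    by rewrite tk subrr.
  by near: k; exact: nts.
suff : \forall k \near k0, O (l k) by [].
near=> k; suff [c ck] : exists c, good c k.
  by move: c ck; near: k; exact: filter_forall.
have [|c [cq cw]] := threshold_chain (q := q) (admissible_coord (l k)).
  by near: k.
by exists c; split.
Unshelve. all: by end_near. Qed.

(* Pushes the coordinates below [u / (1 + u)] to [0] and keeps [1] fixed. *)
Definition shrink (u w : R) : R := Num.max 0 (w - u * (1 - w)).

Lemma shrink0 w : 0 <= w -> shrink 0 w = w.
Proof. by move=> w0; rewrite /shrink mul0r subr0 (max_idPr w0). Qed.

Lemma shrink_1 u : shrink u 1 = 1.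
Proof. by rewrite /shrink subrr mulr0 subr0 (max_idPr ler01). Qed.

Lemma shrink_ge0 u w : 0 <= shrink u w.
Proof. by rewrite le_max lexx. Qed.

Lemma shrink_le1 u w : 0 <= u -> w <= 1 -> shrink u w <= 1.
Proof. by move=> u0 w1; rewrite ge_max ler01 /=; nra. Qed.

Lemma shrink_gt0 u w : 0 <= u -> w <= 1 -> 0 < shrink u w -> 0 < w.
Proof. by move=> u0 w1; rewrite lt_max ltxx /= => h; nra. Qed.

Lemma shrink1_eq0 w : w < 1 / 2 -> shrink 1 w = 0.
Proof. by move=> w2; apply/max_idPl; lra. Qed.

Lemma cvg_shrink (S : Type) (H : set_system S) {FF : Filter H} (f g : S -> R) a b :
  f x @[x --> H] --> a -> g x @[x --> H] --> b ->
  shrink (f x) (g x) @[x --> H] --> shrink a b.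
Proof.
move=> fa gb; apply: cvgr_max; first exact: cvg_cst.
by apply: cvgB => //; apply: cvgM => //; apply: cvgB => //; exact: cvg_cst.
Qed.

Lemma admissible_shrink z w u : 0 <= u -> admissible z w ->
  admissible z (fun s => shrink u (w s)).
Proof.
move=> u0 [w01 wV wA]; split=> [s|s|].
- by have /andP[_ w1] := w01 s; rewrite shrink_ge0 shrink_le1.
- by have /andP[_ w1] := w01 s; move=> /(shrink_gt0 u0 w1); exact: wV.
- apply: ampleS wA; apply/fintype.subsetP => s; rewrite !inE => /eqP ->.
  by rewrite shrink_1.
Qed.

(** Upstairs, on the piece of a chain [c], positive coordinates lie in the label of its first
    member, also after shrinking. So [lift_continuous_at] applies with that member as [q], and
    continuity descends because the interval is compact. *)
Lemma shrink_homotopy : exists sh : unit_interval R * E -> E,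
  [/\ continuous sh, forall p, base (sh p) = base p.2
    & forall p s, coord s (sh p) = shrink (set_val p.1) (coord s p.2)].
Proof.
have ex_sh (p : unit_interval R * E) : exists e : E, base e = base p.2 /\
    coord^~ e =1 (fun s => shrink (set_val p.1) (coord s p.2)).
  apply: admissible_ex; apply: admissible_shrink; first exact: unit_ge0.
  exact: admissible_coord.
have [sh shE] := choice ex_sh.
exists sh; split=> [|p|p s]; last 2 first.
- by have [] := shE p.
- by have [_ ->] := shE p.
apply: quotient_prod_continuous; [exact: unit_interval_compact|
  exact: unit_interval_regular|].
move=> [u [[k c] [x t]]]; rewrite -/(bar_point x t).
pose l (p : unit_interval R * bar R F A) : E := sh (p.1, hocolim_pi p.2).
have baseL p : base (l p) = bar_base p.2.
  by have [-> _] := shE (p.1, hocolim_pi p.2); rewrite baseE.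
have coordL p s : coord s (l p) = shrink (set_val p.1) (bar_coord s p.2).
  by have [_ ->] := shE (p.1, hocolim_pi p.2); rewrite coordE.
apply: (@lift_continuous_at _ l _ (val c ord0)).
- rewrite (_ : (fun p => base (l p)) = (fun p => bar_base p.2)); last exact: funext.
  by apply: continuous_comp; [exact: cvg_snd|exact: bar_base_continuous].
- move=> s; rewrite (_ : (fun p => coord s (l p)) =
    (fun p => shrink (set_val p.1) (bar_coord s p.2))); last exact: funext.
  apply: cvg_shrink.
    by apply: continuous_comp; [exact: cvg_fst|exact: set_val_continuous].
  by apply: continuous_comp; [exact: cvg_snd|exact: bar_coord_continuous].
- by move=> s sc; rewrite baseL /=; apply: (emb_range _ _).1 sc; exists x.
- exists ([set: unit_interval R], [set a | exists y r,
      [/\ True, True & a = @bar_point R _ _ _ F A k c y r]]).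
    split; first exact: filterT.
    exact: (nbhs_bar (N := setT) (M := setT) filterT filterT).
  move=> [v _] /= [_ [y [r [_ _ ->]]]] s; rewrite coordL => /shrink_gt0 h.
  apply: (@bar_coord_gt0 s k c y r); apply: h; first exact: unit_ge0.
  rewrite -coordE.
  by have [/(_ s)/andP[]] := admissible_coord (hocolim_pi (bar_point y r)).
Qed.

(* A lift of [z] whose coordinates have support well inside the [V s]: divide
   functions with cozero sets [z @^-1` V s] by [mu], the largest value they
   attain simultaneously over an ample set, and shrink. *)
Lemma canonical_coordinates (K : topologicalType) (z : K -> Z) :
  continuous z -> (forall k, ample [set s | `[< V s (z k) >]]%SET) ->
  (forall U : set K, open U -> exists2 d : K -> R, continuous d &
    forall k, 0 <= d k /\ (0 < d k <-> U k)) ->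
  exists w : T -> K -> R,
    [/\ forall s, continuous (w s), forall k, admissible (z k) (w^~ k)
      & forall k s, ~ V s (z k) -> \forall k' \near k, w s k' = 0].
Proof.
move=> cz zA cozero.
have ex_dd s : exists dd : K -> R, continuous dd /\
    forall k, 0 <= dd k /\ (0 < dd k <-> V s (z k)).
  have [|dd cdd ddP] := cozero (z @^-1` V s).
    by apply: open_comp => // k _; exact: cz.
  by exists dd.
have [dd dP] := choice ex_dd.
pose mins (S : {set T}) k := \big[Num.min/1]_(s in S) dd s k.
pose mu k := \big[Num.max/0]_(S : {set T} | ample S) mins S k.
have mu_gt0 k : 0 < mu k.
  apply: (lt_le_trans _ (le_bigmax_cond _ (mins^~ k) (zA k))).
  apply: lt_bigmin => [|s]; first exact: ltr01.
  by rewrite inE => /asboolP Vs; apply/((dP s).2 k).2.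
(* On a maximising ample set the quotients [dd s k / mu k] are at least [1], so the truncated
   quotients equal [1] there. *)
have mu_attained k : exists2 S, ample S & forall s, s \in S -> mu k <= dd s k.
  have mins_ge0 S : 0 <= mins S k.
    by apply: le_bigmin => [|s _]; [exact: ler01|have [] := (dP s).2 k].
  exists [arg max_(S > [set s | `[< V s (z k) >]]%SET | ample S) mins S k]%O.
    by case: arg_maxP => //; exact: zA.
  move=> s; rewrite /mu.
  rewrite (@Order.TotalTheory.bigmax_eq_arg _ _ _ _ _ _ (mins^~ k) (zA k)) // => sS.
  exact: (bigmin_le_cond 1 (dd^~ k) sS).
have cmu : continuous mu.
  move=> k; apply: (@cvgr_bigmax R K (nbhs k) _ _ _ _ mins (mins^~ k)) => S _.
  apply: (@cvgr_bigmin R K (nbhs k) _ _ _ _ dd (dd^~ k)) => s _.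
  exact: (dP s).1.
have cq s : continuous (fun k => dd s k / mu k).
  move=> k; apply: cvgM; first exact: (dP s).1.
  by apply: cvgV; [rewrite gt_eqF|exact: cmu].
exists (fun s k => shrink 1 (Num.min 1 (dd s k / mu k))); split=> [s k|k|k s NVs].
- apply: cvg_shrink; first exact: cvg_cst.
  by apply: cvgr_min; [exact: cvg_cst|exact: cq].
- apply: admissible_shrink => //; split=> [s|s|].
  + rewrite le_min ge_min lexx ler01 /= divr_ge0 //; last exact: ltW.
    by have [] := (dP s).2 k.
  + by rewrite lt_min ltr01 /= pmulr_lgt0 ?invr_gt0 // => /((dP s).2 k).2.
  + have [S SA Sd] := mu_attained k; apply: ampleS SA.
    apply/fintype.subsetP => s sS; rewrite inE; apply/eqP/min_idPl.
    by rewrite ler_pdivlMr // mul1r Sd.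
(* Outside [V s] the quotient is [0], hence below [1 / 2] on a neighbourhood, and [shrink 1] sends
   such values to [0]. *)
- have d0 : dd s k = 0.
    have [d_ge0 dV] := (dP s).2 k; apply/le_anti; rewrite d_ge0 andbT leNgt.
    by apply/negP => /dV.
  have : dd s k / mu k < 1 / 2 by rewrite d0 mul0r; lra.
  move=> /(cvgr_lt _ (cq s k)); apply: filterS => k' lt2.
  by apply: shrink1_eq0; rewrite gt_min lt2 orbT.
Qed.

(** Here [n] plays the role of the norm on a cube, and [r] collapses the collar [1 / 2 <= n] onto
    the boundary [n = 1]. Thus [a] composed with [r] lifts [b] composed with [r] over the whole
    collar, which leaves room to interpolate; this is why the lift covers [b (r k)] and not
    [b k]. *)
Lemma relative_lift (K : topologicalType) (n : K -> R) (r : K -> K)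
    (a : K -> E) (b : K -> Z) :
  continuous n -> continuous r ->
  (forall k, n k = 1 -> r k = k) -> (forall k, 1 / 2 <= n k -> n (r k) = 1) ->
  (forall U : set K, open U -> exists2 d : K -> R, continuous d &
    forall k, 0 <= d k /\ (0 < d k <-> U k)) ->
  continuous b -> (forall k, ample [set s | `[< V s (b k) >]]%SET) ->
  (forall k, n k = 1 -> a k' @[k' --> within [set x | n x = 1] (nbhs k)] --> a k) ->
  (forall k, n k = 1 -> base (a k) = b k) ->
  exists l : K -> E, [/\ continuous l, forall k, n k = 1 -> l k = a k
    & forall k, base (l k) = b (r k)].
Proof.
move=> cn cr r1 r2 cozero cb bA ca ab.
have cbr : continuous (fun k => b (r k)).
  by move=> k; apply: continuous_comp; [exact: cr|exact: cb].
have near_gt c k : c < n k -> \forall x \near k, c < n x.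
  exact: cvgr_gt (cn k) c.
have near_lt c k : n k < c -> \forall x \near k, n x < c.
  exact: cvgr_lt (cn k) c.
have [wg [cwg wgP wg0]] := canonical_coordinates cbr (fun k => bA (r k)) cozero.
have [sh [csh bsh wsh]] := shrink_homotopy.
(* Where [n k < 1 / 2] the value [ar k] need not lie over [b (r k)]; the factor [al], zero for
   [n k <= 5 / 8], discards it. *)
pose ar k := a (r k); pose wa s k := coord s (ar k).
have base_ar k : 1 / 2 <= n k -> base (ar k) = b (r k).
  by move=> k2; rewrite /ar ab // r2.
have car k : 1 / 2 < n k -> {for k, continuous ar}.
  move=> k2 O aO.
  have {}aO : nbhs (r k) [set x | n x = 1 -> O (a x)].
    exact: (ca _ (r2 k (ltW k2)) O).
  have nO : \forall x \near k, n (r x) = 1 -> O (ar x) by exact: (cr k _ aO).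
  suff : \forall x \near k, O (ar x) by [].
  near=> x; have : n (r x) = 1 -> O (ar x) by near: x.
  by apply; rewrite r2 // ltW //; near: x; exact: near_gt.
have cwa k s : 1 / 2 < n k -> {for k, continuous (wa s)}.
  by move=> /car ark; apply: continuous_comp => //; exact: coord_continuous.
have wa01 s k : 0 <= wa s k <= 1 by have [/(_ s)] := admissible_coord (ar k).
have clin (x y : R) (k : K) : {for k, continuous (fun k => clip (x * n k + y))}.
  apply: cvg_clip; apply: cvgD; last exact: cvg_cst.
  by apply: cvgM; [exact: cvg_cst|exact: cn].
(* For [n k >= 3 / 4] the lift is the boundary lift, shrunk by [be k]; the
   shrinking is complete for [n k <= 7 / 8], where the support condition thus
   holds, and below that [al] and [ga] interpolate with the lift [wg]. *)
pose al k := clip (16 * n k + - 10).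
pose ga k := clip (- 16 * n k + 12).
pose be k := to_unit (- 8 * n k + 8).
have al1 k : 3 / 4 <= n k -> al k = 1 by move=> ?; apply: clip_ge1; lra.
have al0 k : n k <= 5 / 8 -> al k = 0 by move=> ?; apply: clip_le0; lra.
have ga0 k : 3 / 4 <= n k -> ga k = 0 by move=> ?; apply: clip_le0; lra.
(* At every point one of the two lifts enters the maximum at full strength, so its coordinates equal
   to [1] keep the result ample. *)
have alga k : al k = 1 \/ ga k = 1.
  by case: (leP (3 / 4) (n k)) => k2; [left; exact: al1|
    case: (leP (11 / 16) (n k)) => ?; [left|right]; apply: clip_ge1; lra].
have be1 k : n k <= 7 / 8 -> set_val (be k) = 1 by move=> ?; apply: clip_ge1; lra.
pose wb s k := al k * shrink (set_val (be k)) (wa s k).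
pose W s k := Num.max (wb s k) (ga k * wg s k).
have wgk k : forall s, 0 <= wg s k <= 1 by have [] := wgP k.
have wb0 s k : 0 <= wb s k.
  by rewrite mulr_ge0 ?shrink_ge0 //; have /andP[] := clip01 (16 * n k + - 10).
have al01 k : 0 <= al k <= 1 by exact: clip01.
have ga01 k : 0 <= ga k <= 1 by exact: clip01.
have sh01 s k : 0 <= shrink (set_val (be k)) (wa s k) <= 1.
  rewrite shrink_ge0 shrink_le1 //; first exact: unit_ge0.
  by have /andP[] := wa01 s k.
have WP k : admissible (b (r k)) (W^~ k).
  split=> [s|s|].
  - rewrite le_max wb0 /= ge_max; have := al01 k; have := ga01 k.
    by have := sh01 s k; have := wgk k s; rewrite /wb; nra.
  - rewrite lt_max => /orP[Agt0|].
      have k2 : 5 / 8 < n k.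
        rewrite ltNge; apply/negP => /al0 al_eq.
        by move: Agt0; rewrite /wb al_eq mul0r ltxx.
      rewrite -base_ar; last lra.
      have [_ + _] := admissible_coord (ar k); apply.
      have wle1 : wa s k <= 1 by have /andP[] := wa01 s k.
      apply: (shrink_gt0 (unit_ge0 (be k)) wle1).
      have [/andP[al_ge0 _] /andP[s_ge0 _]] := (al01 k, sh01 s k).
      by move: Agt0; rewrite /wb; nra.
    move=> gw; have [_ + _] := wgP k; apply.
    by have := ga01 k; have := wgk k s; nra.
  - case: (alga k) => [a1|g1].
      have [_ _] := admissible_coord (ar k); apply: ampleS.
      apply/fintype.subsetP => s; rewrite !inE => /eqP ws.
      have := ga01 k; have := wgk k s; rewrite /W /wb a1 /wa ws shrink_1 mulr1 => h1 h2.
      by apply/eqP/max_idPl; nra.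
    have [_ _] := wgP k; apply: ampleS.
    apply/fintype.subsetP => s; rewrite !inE => /eqP ws.
    have := al01 k; have := sh01 s k; rewrite /W g1 ws mulr1 => h1 h2.
    by apply/eqP/max_idPr; rewrite /wb; nra.
have [l lP] := choice (fun k => admissible_ex (WP k)).
(* Near the boundary the support condition may fail, so continuity is taken from the homotopy [sh];
   for [n k <= 3 / 4] it comes from [lift_continuous_at]. *)
have lsh k : 3 / 4 <= n k -> l k = sh (be k, ar k).
  move=> k2; have [lb lw] := lP k; apply: coord_inj => [|s].
    by rewrite lb bsh base_ar //; lra.
  by rewrite lw wsh /W /wb al1 // ga0 // mul1r mul0r (max_idPl (shrink_ge0 _ _)).
exists l; split; last by move=> k; have [] := lP k.
  move=> k; case: (ltP (3 / 4) (n k)) => [k2|k2].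
    rewrite /continuous_at lsh; last exact: ltW.
    have near_sh : \forall x \near k, sh (be x, ar x) = l x.
      by apply: filterS (near_gt _ _ k2) => x x2; rewrite lsh // ltW.
    apply: cvg_trans (near_eq_cvg near_sh) _.
    have cbe : {for k, continuous be}.
      apply: cvg_to_unit; apply: cvgD; last exact: cvg_cst.
      by apply: cvgM; [exact: cvg_cst|exact: cn].
    have k2' : 1 / 2 < n k by lra.
    exact: cvg_comp (cvg_pair cbe (car k k2')) (csh (be k, ar k)).
  have k78 : n k < 7 / 8 by lra.
  have [q qE] : exists q, lab q = [set s | `[< V s (b (r k)) >]]%SET.
    by apply: (@lab_onto (b (r k))) => s; rewrite inE => /asboolP.
  apply: (@lift_continuous_at _ l k q).
  - rewrite (_ : (fun k => base (l k)) = (fun k => b (r k))); first exact: cbr.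
    by apply: funext => x; have [] := lP x.
  - move=> s; rewrite (_ : (fun k => coord s (l k)) = W s); last first.
      by apply: funext => x; have [_ ->] := lP x.
    apply: cvgr_max; last by apply: cvgM; [exact: clin|exact: cwg].
    case: (ltP (n k) (5 / 8)) => [k58|k58].
      have near_A : \forall x \near k, 0 = wb s x.
        by apply: filterS (near_lt _ _ k58) => x /ltW x58; rewrite /wb al0 // mul0r.
      rewrite {2}/wb al0 ?mul0r; last exact: ltW.
      by apply: cvg_trans (near_eq_cvg near_A) _; exact: cvg_cst.
    apply: cvgM; first exact: clin.
    apply: cvg_shrink; last by apply: cwa; lra.
    exact: clin.
  - by move=> s; rewrite qE inE => /asboolP Vs; have [->] := lP k.
  - apply: filter_forall => s; rewrite qE inE.
    have [Vs|NVs] := pselect (V s (b (r k))).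
      by apply: nearW => x _; apply/asboolP.
    (* Either [al] vanishes near [k], or the shrinking is complete there and kills [wa s], which is
       [0] at [k] because the base point is outside [V s]. *)
    have near_A : \forall x \near k, wb s x = 0.
      case: (ltP (n k) (5 / 8)) => [k58|k58].
        by apply: filterS (near_lt _ _ k58) => x /ltW x58; rewrite /wb al0 // mul0r.
      have wa2 : wa s k < 1 / 2.
        have [_ h _] := admissible_coord (ar k).
        have wle0 : wa s k <= 0.
          rewrite leNgt; apply/negP => /h; rewrite base_ar //; lra.
        lra.
      have k2' : 1 / 2 < n k by lra.
      near=> x; rewrite /wb be1; last by apply: ltW; near: x; exact: near_lt.
      by rewrite shrink1_eq0 ?mulr0 //; near: x; exact: cvgr_lt _ (cwa k s k2') _ wa2.
    have near_g := wg0 k s NVs.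
    near=> x; have [_ ->] := lP x; rewrite /W.
    rewrite (_ : wb s x = 0); last by near: x; exact: near_A.
    rewrite (_ : wg s x = 0); last by near: x; exact: near_g.
    by rewrite mulr0 maxxx ltxx.
move=> k k1; rewrite lsh ?k1; last lra.
have -> : a k = ar k by rewrite /ar r1.
apply: coord_inj => [|s]; first by rewrite bsh.
have be0 : set_val (be k) = 0 by apply: clip_le0; rewrite k1; lra.
by rewrite wsh be0 shrink0 //; have /andP[] := wa01 s k.
Unshelve. all: by end_near. Qed.

(** * Lifting over cubes and the consequences for homotopy groups *)

Lemma cube_lift (k : nat) (a : cube R k -> E) (b : cube R k -> Z) :
  continuous b -> (forall s, ample [set i | `[< V i (b s) >]]%SET) ->
  (forall s, cube_bdry s ->
    a t @[t --> within (@cube_bdry R k) (nbhs s)] --> a s) ->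
  (forall s, cube_bdry s -> base (a s) = b s) ->
  exists l : cube R k -> E, [/\ continuous l, forall s, cube_bdry s -> l s = a s
    & forall s, base (l s) = b (radial (1 / 2) s)].
Proof.
move=> cb bA ca ab.
have bdryE : @cube_bdry R k = [set s | cube_norm s = 1].
  by apply/funext => s; apply/propext/cube_bdryE.
have half_gt0 : 0 < 1 / 2 :> R by lra.
have [] := @relative_lift _ (@cube_norm R k) (radial (1 / 2)) a b.
- by move=> s; exact: (@cvg_cube_norm _ _ _ (nbhs s) (nbhs_filter s) id).
- move=> s; apply: (@cvg_radial _ _ _ (nbhs s) (nbhs_filter s) (fun=> 1 / 2) id) => //.
  exact: cvg_cst.
- by move=> s; apply: radial_bdry; lra.
- exact: radial_to_bdry.
- exact: cube_cozero.
- exact: cb.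
- exact: bA.
- by rewrite -bdryE => s /cube_bdryE; exact: ca.
- by move=> s /cube_bdryE; exact: ab.
by move=> l [cl la lb]; exists l; split=> // s /cube_bdryE; exact: la.
Qed.

Section CubeSplit.
Variable k : nat.

Definition cube_tail (s : cube R k.+1) : cube R k := fun i => s (lift ord0 i).

Definition cube_cons (p : unit_interval R * cube R k) : cube R k.+1 :=
  fun i => oapp p.2 p.1 (unlift ord0 i).

Lemma cube_cons0 p : cube_cons p ord0 = p.1.
Proof. by rewrite /cube_cons unlift_none. Qed.

Lemma cube_consK p : cube_tail (cube_cons p) = p.2.
Proof. by apply: funext => i; rewrite /cube_tail /cube_cons liftK. Qed.

Lemma cube_tail_continuous : continuous cube_tail.
Proof. by apply: ptws_continuous => i; exact: ptws_proj_continuous. Qed.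

Lemma cube_cons_continuous : continuous cube_cons.
Proof.
apply: ptws_continuous => i; rewrite /cube_cons.
case: unliftP => [j _|_] p /=; last exact: cvg_fst.
apply: (@continuous_comp _ _ _ snd (fun t : cube R k => t j)); first exact: cvg_snd.
exact: ptws_proj_continuous.
Qed.

Lemma cube_bdry_cons (s : cube R k.+1) : cube_bdry s <->
  [\/ set_val (s ord0) = 0, set_val (s ord0) = 1 | cube_bdry (cube_tail s)].
Proof.
split=> [[i]|].
  case: (unliftP ord0 i) => [j|] -> h; first by constructor 3; exists j.
  by case: h => h; [constructor 1|constructor 2].
by case=> [h|h|[j h]]; [exists ord0; left|exists ord0; right|exists (lift ord0 j)].
Qed.

End CubeSplit.

Variables (W : topologicalType) (iota : W -> Z) (eta : E -> W).
Hypothesis iota_continuous : continuous iota.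
Hypothesis iota_inj : injective iota.
Hypothesis eta_continuous : continuous eta.
Hypothesis iota_eta : forall e, iota (eta e) = base e.
Hypothesis iota_ample : forall y, ample [set s | `[< V s (iota y) >]]%SET.

(** A lifting problem on the cube of dimension [k.+1]: [A0] prescribes [a] and [b] on two opposite
    faces and [x] on the others. Only the boundary values of the lift matter. The case [k = 0], with
    empty boundary conditions on [a] and [b], handles path components. *)
Lemma lift_based_homotopy k (x : E) (a b : cube R k -> E) :
  continuous a -> continuous b ->
  (forall s, cube_bdry s -> a s = x) -> (forall s, cube_bdry s -> b s = x) ->
  based_homotopic (eta x) (eta \o a) (eta \o b) -> based_homotopic x a b.
Proof.
move=> ca cb ax bx [h [ch ha hb hx]].
pose A0 (s : cube R k.+1) : E :=
  if set_val (s ord0) == 0 then a (cube_tail s)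
  else if set_val (s ord0) == 1 then b (cube_tail s) else x.
have A00 s : set_val (s ord0) = 0 -> A0 s = a (cube_tail s).
  by rewrite /A0 => ->; rewrite eqxx.
have A01 s : set_val (s ord0) = 1 -> A0 s = b (cube_tail s).
  by rewrite /A0 => ->; rewrite oner_eq0 eqxx.
have A0x s : cube_bdry (cube_tail s) -> A0 s = x.
  by move=> sb; rewrite /A0 ax // bx // !if_same.
pose B (s : cube R k.+1) : Z := iota (h (s ord0, cube_tail s)).
have chead : continuous (fun s : cube R k.+1 => set_val (s ord0) : R).
  by move=> s; exact: (@cvg_cube_coord _ _ _ _ (nbhs_filter s) id).
have closed_head (c : R) : closed [set s : cube R k.+1 | set_val (s ord0) = c].
  rewrite (_ : [set s | _] =
    (fun s : cube R k.+1 => set_val (s ord0) : R) @^-1` [set c]) //.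
  by apply: closed_comp => [s _|]; [exact: chead|exact: closed_eq].
have closed_bdry : closed [set s : cube R k.+1 | cube_bdry (cube_tail s)].
  rewrite (_ : [set s | _] = (fun s => cube_norm (cube_tail s)) @^-1` [set 1]).
    apply: closed_comp => [s _|]; last exact: closed_eq.
    exact: (@cvg_cube_norm _ _ _ _ (nbhs_filter s) _ _ (@cube_tail_continuous k s)).
  by apply/funext => s; apply/propext/cube_bdryE.
have [|s|s sb O|s|l [cl lA lB]] := @cube_lift k.+1 A0 B.
- move=> s; apply: continuous_comp; last exact: iota_continuous.
  apply: (@continuous_comp _ _ _ (fun s : cube R k.+1 => (s ord0, cube_tail s)) h);
    last exact: ch.
  apply: pair_continuous => {}s; last exact: cube_tail_continuous.
  exact: ptws_proj_continuous.
- exact: iota_ample.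
- move=> nO; suff : \forall t \near s, cube_bdry t -> O (A0 t) by [].
  (* The boundary is covered by three closed pieces, on each of which [A0] is given by a continuous
     formula. *)
  have O0 : \forall t \near s, set_val (t ord0) = 0 -> O (A0 t).
    apply: (@near_closed _ _ (A0 @^-1` O) s (closed_head 0)) => s0.
    have cat : nbhs s [set t | O (a (cube_tail t))].
      by apply: (@cube_tail_continuous k s (a @^-1` O)); apply: ca; rewrite -A00.
    by apply: filterS cat => t Ot /A00; rewrite /= => ->.
  have O1 : \forall t \near s, set_val (t ord0) = 1 -> O (A0 t).
    apply: (@near_closed _ _ (A0 @^-1` O) s (closed_head 1)) => s1.
    have cbt : nbhs s [set t | O (b (cube_tail t))].
      by apply: (@cube_tail_continuous k s (b @^-1` O)); apply: cb; rewrite -A01.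
    by apply: filterS cbt => t Ot /A01; rewrite /= => ->.
  have Ox : \forall t \near s, cube_bdry (cube_tail t) -> O (A0 t).
    apply: (@near_closed _ _ (A0 @^-1` O) s closed_bdry) => sx.
    apply: (@filterE _ (nbhs s)) => t tb; rewrite /= A0x // -(A0x s) //.
    exact: nbhs_singleton nO.
  near=> t => /cube_bdry_cons[t0|t1|tb].
  + by move: t0; near: t.
  + by move: t1; near: t.
  + by move: tb; near: t.
- move=> /cube_bdry_cons; rewrite -iota_eta => -[s0|s1|sb]; congr iota.
  + by rewrite A00 // ha.
  + by rewrite A01 // hb.
  + by rewrite A0x // hx.
exists (fun p => l (cube_cons p)); split=> [p|u s u0|u s u1|u s sb].
- by apply: continuous_comp; [exact: cube_cons_continuous|exact: cl].
- have p0 : set_val (cube_cons (u, s) ord0) = 0 by rewrite cube_cons0.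
  by rewrite lA ?A00 ?cube_consK //; apply/cube_bdry_cons; constructor 1.
- have p1 : set_val (cube_cons (u, s) ord0) = 1 by rewrite cube_cons0.
  by rewrite lA ?A01 ?cube_consK //; apply/cube_bdry_cons; constructor 2.
- have pb : cube_bdry (cube_tail (cube_cons (u, s))) by rewrite cube_consK.
  by rewrite lA ?A0x //; apply/cube_bdry_cons; constructor 3.
Unshelve. all: by end_near. Qed.

(** [cube_lift] with constant boundary value gives a lift of [b] composed with [radial (1 / 2)].
    Letting the radius grow from [1 / 2] to [1] is a homotopy back to [b] that fixes the
    boundary. *)
Lemma lift_based_map k (x : E) (b : cube R k -> W) : based_map (eta x) b ->
  exists2 a : cube R k -> E, based_map x a & based_homotopic (eta x) (eta \o a) b.
Proof.
move=> [cb bx].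
have half (u : R) : 0 <= u -> 0 < 1 / 2 + u / 2 by lra.
have [|s|s sb|s sb|l [cl lx lb]] := @cube_lift k (fun=> x) (iota \o b).
- by move=> s; apply: continuous_comp; [exact: cb|exact: iota_continuous].
- exact: iota_ample.
- exact: cvg_cst.
- by rewrite /= bx // iota_eta.
exists l; first by split.
exists (fun p => b (radial (1 / 2 + set_val p.1 / 2) p.2)); split.
- move=> p; apply: continuous_comp; last exact: cb.
  apply: (@cvg_radial _ _ _ (nbhs p) (nbhs_filter p)
    (fun p : unit_interval R * cube R k => 1 / 2 + set_val p.1 / 2) snd).
  + by apply: half; exact: unit_ge0.
  + apply: cvgD; first exact: cvg_cst.
    apply: cvgM; last exact: cvg_cst.
    by apply: continuous_comp; [exact: cvg_fst|exact: set_val_continuous].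
  + exact: cvg_snd.
- by move=> u s u0; apply: iota_inj; rewrite iota_eta lb u0 mul0r addr0.
- move=> u s u1; rewrite u1 (_ : 1 / 2 + 1 / 2 = 1); last by lra.
  by rewrite radial1.
- move=> u s sb; rewrite radial_bdry ?bx //; last exact/cube_bdryE.
  by have := unit_le1 u; rewrite /=; lra.
Qed.

Lemma base_weak_equivalence : weak_homotopy_equivalence R eta.
Proof.
split=> [||x k _]; first exact: eta_continuous.
- split=> [x x' [c [cc c0 c1]]|y].
    pose pt : cube R 0 := fun=> to_unit 0.
    have nobdry (s : cube R 0) : ~ cube_bdry s by move=> [[]].
    have [|||||h [ch h0 h1 _]] :=
      @lift_based_homotopy 0 x (fun=> x) (fun=> x').
    + exact: cst_continuous.
    + exact: cst_continuous.
    + by [].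
    + by move=> s /nobdry.
    + exists (fun p => c p.1); split=> [p|u s|u s|u s /nobdry//].
      * by apply: continuous_comp; [exact: cvg_fst|exact: cc].
      * exact: c0.
      * exact: c1.
    + exists (fun u => h (u, pt)); split=> [u|u u0|u u1].
      * apply: (@continuous_comp _ _ _ (fun u => (u, pt)) h); last exact: ch.
        by apply: pair_continuous => {}u; [exact: cvg_id|exact: cst_continuous].
      * exact: h0.
      * exact: h1.
  (* A preimage of [y] itself, with weight [1] on every label whose open set contains [iota y]. *)
  have [e [ey _]] : exists e : E, base e = iota y /\
      coord^~ e =1 (fun s => (`[< V s (iota y) >])%:R).
    apply: admissible_ex; split=> [s|s|].
    + by case: asboolP => _; rewrite /= ?ler01 lexx.
    + by case: asboolP => // _; rewrite ltxx.
    + apply: ampleS (iota_ample y); apply/fintype.subsetP => s.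
      by rewrite !finset.inE => ->.
  exists e; exists (fun=> y); split=> // [|u _].
    exact: cst_continuous.
  by apply: iota_inj; rewrite iota_eta.
- split=> [a b [ca ax] [cb bx]|]; first exact: lift_based_homotopy.
  exact: lift_based_map.
Qed.

End Coordinates.

(** * Pairs of graphs as label sets, and non-collisions as open sets *)

Lemma near_neq (K X : topologicalType) (f g : K -> X) (k0 : K) :
  hausdorff_space X -> continuous f -> continuous g -> f k0 <> g k0 ->
  \forall k \near k0, f k <> g k.
Proof.
rewrite open_hausdorff => hX cf cg /eqP/hX[[B C]] /= [fB gC] [oB oC BC].
have nB : nbhs k0 (f @^-1` B).
  by apply: cf; apply: open_nbhs_nbhs; split => //; exact: set_mem.
have nC : nbhs k0 (g @^-1` C).
  by apply: cg; apply: open_nbhs_nbhs; split => //; exact: set_mem.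
apply: filterS2 nB nC => k Bk Ck fg.
have : (B `&` C) (f k) by split => //; rewrite fg.
by move/eqP: BC => ->.
Qed.

Section ConfCover.
Variables (R : realType) (G H : topGroupType) (X Y : topologicalType).
Hypotheses (hX : hausdorff_space X) (hY : hausdorff_space Y).
Variables (a : gaction G X) (b : gaction H Y) (n : nat).

Local Notation P := ((graph n)^d *p (graph n)^d)%type.
Local Notation F := (xprod (conf_diagram n a) (conf_diagram n b)).
Local Notation Z := {ptws 'I_n -> (X * Y)%type}.
Local Notation T := (bool * {set 'I_n})%type.

Definition label (p : P) : {set T} :=
  [set s : T | s.2 \in edges (if s.1 then p.1 else p.2 : graph n)]%SET.

Definition covers (Gam : graph n) (S : {set T}) : bool :=
  [forall e in edges Gam, ((true, e) \in S) || ((false, e) \in S)].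

(** The cardinality clause makes every set of labels with a common point the label set of a pair of
    graphs. Quantifying over all presentations of the edge avoids ordering its ends. *)
Definition separated (s : T) : set Z := [set z | #|s.2| = 2 /\
  forall i j, s.2 = [set i; j]%SET ->
    if s.1 then (z i).1 <> (z j).1 else (z i).2 <> (z j).2].

Definition zip_conf (p : P) (x : F p) : Z :=
  fun i => (set_val x.1 i, set_val x.2 i).

Lemma label_le (p q : P) : (p <= q)%O = (label q \subset label p).
Proof.
rewrite leEprod; apply/andP/fintype.subsetP =>
  [[/fintype.subsetP h1 /fintype.subsetP h2] [[] e]|h].
- by rewrite !finset.inE; exact: h1.
- by rewrite !finset.inE; exact: h2.
split; apply/fintype.subsetP => e eq.
- by have := h (true, e); rewrite !finset.inE; apply.
- by have := h (false, e); rewrite !finset.inE; apply.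
Qed.

Lemma label_covers (Gam : (graph n)^d) (p : P) :
  (p \in slice (@graph_union_op n : {omorphism P -> (graph n)^d}) Gam) =
    covers Gam (label p).
Proof.
rewrite inE; apply/fintype.subsetP/forall_inP => h e /h;
  by rewrite !finset.inE.
Qed.

Lemma coversS (Gam : graph n) (S S' : {set T}) :
  S \subset S' -> covers Gam S -> covers Gam S'.
Proof.
move=> /fintype.subsetP SS' /forall_inP h; apply/forall_inP => e /h.
by case/orP => /SS' ->; rewrite ?orbT.
Qed.

Lemma fst_coord_continuous i : continuous (fun z : Z => (z i).1).
Proof.
move=> z; apply: (@continuous_comp _ _ _ (fun z : Z => z i) fst); last exact: cvg_fst.
exact: ptws_proj_continuous.
Qed.

Lemma snd_coord_continuous i : continuous (fun z : Z => (z i).2).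
Proof.
move=> z; apply: (@continuous_comp _ _ _ (fun z : Z => z i) snd); last exact: cvg_snd.
exact: ptws_proj_continuous.
Qed.

(** The Hausdorff hypotheses on [X] and [Y] enter here: through [near_neq], distinctness of two
    coordinates is an open condition. *)
Lemma separated_open s : open (separated s).
Proof.
rewrite openE => z [s2 sz]; rewrite /interior /=.
suff : \forall z' \near z, forall i j, s.2 = [set i; j]%SET ->
    if s.1 then (z' i).1 <> (z' j).1 else (z' i).2 <> (z' j).2.
  by apply: filterS => z' h; split.
suff near_ij i j : \forall z' \near z, s.2 = [set i; j]%SET ->
    if s.1 then (z' i).1 <> (z' j).1 else (z' i).2 <> (z' j).2.
  have nz := nbhs_filter z.
  exact: (@filter_forall _ _ _ _ nz
    (fun i => @filter_forall _ _ _ _ nz (near_ij i))).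
have [sij|sij] := pselect (s.2 = [set i; j]%SET); last first.
  by apply: (@filterE _ (nbhs z)) => z' /sij.
have := sz i j sij; case: s.1 => neq.
- have := near_neq hX (@fst_coord_continuous i) (@fst_coord_continuous j) neq.
  by apply: filterS => z' h _.
- have := near_neq hY (@snd_coord_continuous i) (@snd_coord_continuous j) neq.
  by apply: filterS => z' h _.
Qed.

Lemma edge_card (Gam : graph n) e : e \in edges Gam -> #|e| = 2.
Proof. by have /forall_inP h := edges_card Gam => /h/eqP. Qed.

Lemma zip_conf_range (p : P) (z : Z) :
  (exists x : F p, zip_conf x = z) <-> (forall s, s \in label p -> separated s z).
Proof.
split=> [[[x y] <-] [[] e] /[!finset.inE] /= ep|h].
- split; first exact: edge_card ep.
  by move=> i j /= eij; apply: (set_valP x i j); rewrite /adj -eij.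
- split; first exact: edge_card ep.
  by move=> i j /= eij; apply: (set_valP y i j); rewrite /adj -eij.
have z1 : ((fun i => (z i).1) : {ptws 'I_n -> X}) \in conf X (p.1 : graph n).
  apply: mem_set => i j ij; have [|_ h1] := h (true, [set i; j]%SET).
    by rewrite finset.inE.
  exact: h1.
have z2 : ((fun i => (z i).2) : {ptws 'I_n -> Y}) \in conf Y (p.2 : graph n).
  apply: mem_set => i j ij; have [|_ h1] := h (false, [set i; j]%SET).
    by rewrite finset.inE.
  exact: h1.
exists (SigSub z1 : conf_ob X p.1, SigSub z2 : conf_ob Y p.2).
by apply: funext => i; rewrite [RHS]surjective_pairing.
Qed.

Lemma zip_conf_dmap (p q : P) (pq : (p <= q)%O) (x : F p) :
  zip_conf (dmap F pq x) = zip_conf x.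
Proof. by []. Qed.

Lemma zip_conf_inj (p : P) : injective (@zip_conf p).
Proof.
move=> [x1 y1] [x2 y2] xy; congr pair; apply/val_inj/funext => i.
- by have := congr1 (fun z : Z => (z i).1) xy.
- by have := congr1 (fun z : Z => (z i).2) xy.
Qed.

Lemma conf_coord_continuous (X' : topologicalType) (Gam : graph n) i :
  continuous (fun x : set_type (conf X' Gam) => set_val x i).
Proof.
move=> x; apply: (@continuous_comp _ _ _ (@set_val _ (conf X' Gam))
  (fun z : {ptws 'I_n -> X'} => z i)); first exact: set_val_continuous.
exact: ptws_proj_continuous.
Qed.

Lemma zip_conf_continuous (p : P) : continuous (@zip_conf p).
Proof.
apply: ptws_continuous => i; apply: pair_continuous => x.
- apply: (@continuous_comp _ _ _ fst (fun x : conf_ob X p.1 => set_val x i)).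
    exact: cvg_fst.
  exact: conf_coord_continuous.
- apply: (@continuous_comp _ _ _ snd (fun x : conf_ob Y p.2 => set_val x i)).
    exact: cvg_snd.
  exact: conf_coord_continuous.
Qed.

Lemma zip_conf_initial (p : P) (x : F p) N : nbhs x N ->
  exists2 M, nbhs (zip_conf x) M & forall y : F p, M (zip_conf y) -> N y.
Proof.
case: x => x1 x2 [[N1 N2] /= [N1x N2x] NN].
have [M1 M1x M1N] := nbhs_subtype N1x.
have [M2 M2x M2N] := nbhs_subtype N2x.
have c1 : continuous ((fun z i => (z i).1) : Z -> {ptws 'I_n -> X}).
  by apply: ptws_continuous; exact: fst_coord_continuous.
have c2 : continuous ((fun z i => (z i).2) : Z -> {ptws 'I_n -> Y}).
  by apply: ptws_continuous; exact: snd_coord_continuous.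
exists [set z : Z | M1 (fun i => (z i).1) /\ M2 (fun i => (z i).2)].
  by apply: filterI; [exact: (c1 _ M1)|exact: (c2 _ M2)].
move=> [y1 y2] [My1 My2]; apply: (NN (y1, y2)).
by split; [exact: M1N|exact: M2N].
Qed.

Lemma label_onto (z : Z) (S : {set T}) :
  (forall s, s \in S -> separated s z) -> exists p : P, label p = S.
Proof.
move=> Sz.
have cardS c : [forall e in [set e | (c, e) \in S]%SET, #|e| == 2].
  apply/forall_inP => e; rewrite finset.inE => /Sz[eq2 _].
  exact/eqP.
exists (Graph (cardS true), Graph (cardS false)).
by apply/finset.setP => -[[] e]; rewrite !finset.inE.
Qed.

(** Distinct points of [X * Y] differ in one of the factors, so each edge of [Gam] is a
    non-collision in [X] or in [Y]. *)
Lemma conf_covered (Gam : graph n) (z : Z) : conf _ Gam z ->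
  covers Gam [set s | `[< separated s z >]]%SET.
Proof.
move=> zG; apply/forall_inP => e eG; rewrite !finset.inE.
have e2 := edge_card eG.
have /cards2P[i [j [ij eij]]] := introT eqP e2.
have neq : z i <> z j by apply: zG; rewrite /adj -eij.
have other i' j' : e = [set i'; j']%SET ->
    (i' = i /\ j' = j) \/ (i' = j /\ j' = i).
  move=> ee; have ie : i \in [set i'; j']%SET by rewrite -ee eij !finset.inE eqxx.
  have je : j \in [set i'; j']%SET by rewrite -ee eij !finset.inE eqxx orbT.
  move: ie je ij; rewrite !finset.inE => /orP[]/eqP-> /orP[]/eqP->; rewrite ?eqxx //.
  - by left.
  - by right.
have [eq1|neq1] := pselect ((z i).1 = (z j).1).
  apply/orP; right; apply/asboolP; split=> //= i' j' /other [] [-> ->] eq2;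
    by apply: neq; move: eq1 eq2; case: (z i) => ? ?; case: (z j) => ? ? /= -> ->.
by apply/orP; left; apply/asboolP; split=> //= i' j' /other [] [-> ->] // /esym.
Qed.

Lemma covers_conf (Gam : graph n) (z : Z) (S : {set T}) :
  covers Gam S -> (forall s, s \in S -> separated s z) -> conf _ Gam z.
Proof.
move=> /forall_inP cS Sz i j ij zij; case/orP: (cS _ ij) => /Sz[_] /(_ i j erefl) /=;
  by rewrite zij.
Qed.

(** * The comparison map: naturality, equivariance, weak equivalence *)

Local Notation E Gam := (lkan_ob R
  (@graph_union_op n : {omorphism P -> (graph n)^d}) F Gam).

Definition union_base (Gam : (graph n)^d) (e : E Gam) : Z := base zip_conf e.

Lemma union_base_conf Gam (e : E Gam) : union_base e \in conf _ Gam.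
Proof.
apply: mem_set.
have [_ h1 h2] := admissible_coord label_le (label_covers Gam)
  (@coversS Gam) zip_conf_range zip_conf_dmap e.
apply: (covers_conf h2) => s; rewrite finset.inE => /eqP s1.
by apply: h1; rewrite s1.
Qed.

Definition union_map (Gam : (graph n)^d) (e : E Gam) :
  conf_diagram n (prod_gaction a b) Gam := SigSub (union_base_conf e).

Lemma union_baseE Gam (x : bar R F _) :
  union_base (hocolim_pi x : E Gam) = bar_base zip_conf x.
Proof. exact: baseE zip_conf_dmap x. Qed.

Lemma union_map_continuous Gam : continuous (@union_map Gam).
Proof.
apply: subtype_continuous; exact: base_continuous zip_conf_dmap zip_conf_continuous.
Qed.

Lemma union_map_natural Gam Gam' (h : (Gam <= Gam')%O) (e : E Gam) :
  union_map (lkan_map h e) =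
    dmap (conf_diagram n (prod_gaction a b)) h (union_map e).
Proof.
apply: val_inj; rewrite -[LHS]/(union_base (lkan_map h e)) -[RHS]/(union_base e).
elim/hocolim_ind: e => x.
by rewrite lkan_mapE !union_baseE; case: x => -[k c] xt.
Qed.

Lemma union_map_act Gam g (e : E Gam) :
  union_map (lkan_act g e) =
    dact (conf_diagram n (prod_gaction a b)) g (union_map e).
Proof.
apply: val_inj; apply: funext => i; rewrite -[LHS]/(union_base (lkan_act g e) i).
rewrite -[RHS]/(prod_act a b g (union_base e i)); elim/hocolim_ind: e => x.
by rewrite lkan_actE !union_baseE; case: x => -[k c] xt.
Qed.

Definition union_hom : gdiagram_hom (lkan R
    (@graph_union_op n : {omorphism P -> (graph n)^d}) F)
    (conf_diagram n (prod_gaction a b)) :=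
  @GDiagramHom _ _ _ (lkan R _ F) (conf_diagram n (prod_gaction a b))
    union_map union_map_continuous union_map_natural union_map_act.

Lemma union_hom_weak_equivalence : diagram_weak_equivalence R union_hom.
Proof.
move=> Gam; apply: (base_weak_equivalence label_le (label_covers Gam)
  (@coversS Gam) separated_open zip_conf_range zip_conf_dmap zip_conf_inj
  zip_conf_continuous zip_conf_initial label_onto (iota := @set_val _ (conf _ Gam))).
- exact: set_val_continuous.
- exact: val_inj.
- exact: union_map_continuous.
- by [].
- by move=> z; apply: conf_covered; exact: set_valP.
Qed.

End ConfCover.

Theorem theorem1p8 (R : realType) (G H : topGroupType)
    (X Y : topologicalType)
    (hX : hausdorff_space X) (hY : hausdorff_space Y)
    (a : gaction G X) (b : gaction H Y) (n : nat) :
  exists eta : gdiagram_hom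
      (lkan R (@graph_union_op n : {omorphism (graph n)^d *p (graph n)^d -> (graph n)^d})
         (xprod (conf_diagram n a) (conf_diagram n b)))
      (conf_diagram n (prod_gaction a b)),
    diagram_weak_equivalence R eta.
Proof. by exists (union_hom R a b n); exact: union_hom_weak_equivalence. Qed.
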